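(* Consider the following family of instances of online bipartite matching with homogeneous groups, indexed by an integer $n\ge 2$: the online types are $J=\{0,1,\dots,n\}$ with arrival rates $\lambda_t=1/n$ for $t=1,\dots,n$ and $\lambda_0=n-1$; the offline agents are $I=\{1,\dots,n\}$, each with capacity $b_t=1$; offline agent $t$ is eligible to serve exactly the online types $t$ and $0$. Under the long-run fairness objective, any non-rejecting online algorithm is no more than $1/2$-competitive relative to the best clairvoyant algorithm on this family; that is, there is no constant $c>1/2$ such that, for every $n$, the long-run fairness of the non-rejecting online algorithm is at least $c$ times the long-run fairness of the optimal clairvoyant algorithm.
   Context: Model: $I$ is a finite set of offline agents, $J$ a finite set of online types, and $E\subseteq I\times J$ the set of eligible (offline agent, online type) pairs; $\mathcal N_j=\{i:(i,j)\in E\}$. Each offline agent $i$ has an integer capacity $b_i\ge1$, the maximum number of online agents it can serve. Online agents of each type $j$ arrive according to mutually independent Poisson processes of constant rate $\lambda_j>0$ over the time horizon $[0,1]$. When an online agent arrives its type is revealed, and an online algorithm (possibly randomized, knowing all parameters in advance) must immediately and irrevocably either serve it using some $i\in\mathcal N_j$ that has not reached capacity, or reject it. A non-rejecting online algorithm is one that always serves an arriving agent whenever some eligible offline agent still has remaining capacity. A clairvoyant algorithm knows the whole realization of arrivals in advance and then makes (possibly randomized) assignments subject to the same eligibility and capacity constraints. Homogeneous groups: each protected group consists of a single online type, one group per type. With $X_j$ the number of type-$j$ agents served, the long-run fairness of an algorithm is $\min_{j\in J}\mathbb E[X_j]/\lambda_j$, expectation over arrivals and the algorithm's randomness. An online algorithm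 is $c$-competitive on a class of instances if its objective value is at least $c$ times that of the optimal clairvoyant algorithm on every instance of the class. *)

(* Defs.v *)
From HB Require Import structures.
From mathcomp Require Import all_boot all_order all_algebra.
From mathcomp Require Import all_classical all_reals all_analysis.

Set Implicit Arguments.
Unset Strict Implicit.
Unset Printing Implicit Defensive.

Import Order.TTheory GRing.Theory Num.Theory.
Import numFieldNormedType.Exports.

Local Open Scope classical_set_scope.
Local Open Scope ring_scope.

Record instance (R : realType) := Instance {
  offline : finType;
  types : finType;
  eligible : offline -> types -> bool;
  cap : offline -> nat;
  rate : types -> R;
  cap_gt0 : forall i, (0 < cap i)%N;
  rate_gt0 : forall j, 0 < rate j
}.

Section Arrivals.
Variables (R : realType) (J : finType).

(* A realization of the arrivals is the list of all (arrival time, type) pairs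
   over the horizon, in chronological order. Simultaneous arrivals and arrivals
   at time 0 have probability 0 and are excluded. *)
Definition realization := seq (R * J).

Definition valid (a : realization) : bool :=
  sorted <%R [seq x.1 | x <- a] && all (fun x => 0 < x.1 <= 1) a.

Definition arrivals_upto (j : J) (t : R) (a : realization) : nat :=
  count (fun x => (x.2 == j) && (x.1 <= t)) a.

End Arrivals.

Section Poisson.
Variables (R : realType) (d : measure_display) (Omega : measurableType d).
Variable P : probability Omega R.

(* Mutual independence of a finite family of countably-valued random variables;
   the product rule for subfamilies follows by summing over the other values. *)
Definition mutually_independent (K : finType) (V : countType)
    (X : K -> Omega -> V) : Prop :=
  forall v : K -> V,
    P [set w | forall k, X k w = v k] =
    (\prod_(k : K) P [set w | X k w = v k])%E.

(* N is a Poisson (counting) process of constant rate lam on [0, 1]. *)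
Definition poisson_process (N : R -> Omega -> nat) (lam : R) : Prop :=
  [/\ forall t, 0 <= t <= 1 -> measurable_fun [set: Omega] (N t),
      forall w, N 0 w = 0%N /\
        {in `[0, 1] &, {homo N^~ w : s t / s <= t >-> (s <= t)%N}},
      (* independent increments *)
      forall (m : nat) (t : nat -> R),
        0 <= t 0%N -> t m <= 1 -> (forall l, (l < m)%N -> t l < t l.+1) ->
        mutually_independent
          (fun (l : 'I_m) w => (N (t l.+1) w - N (t l) w)%N) &
      forall (s t : R), 0 <= s -> s < t -> t <= 1 -> forall k : nat,
        P [set w | (N t w - N s w)%N = k] =
        (poisson_pmf (lam * (t - s)) k)%:E].

(* Mutual independence of a finite family of counting processes, through their
   finite-dimensional marginals. *)
Definition independent_processes (K : finType) (N : K -> R -> Omega -> nat)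
    : Prop :=
  forall (m : nat) (t : 'I_m -> R), (forall l, 0 <= t l <= 1) ->
    mutually_independent (fun k w => [tuple N k (t l) w | l < m]).

End Poisson.

Record arrival_model (R : realType) (inst : instance R) := ArrivalModel {
  arr_disp : measure_display;
  arr_space : measurableType arr_disp;
  arr_law : probability arr_space R;
  arr : arr_space -> realization R (types inst);
  arr_valid : forall w, valid (arr w);
  arr_poisson : forall j,
    poisson_process arr_law (fun t w => arrivals_upto j t (arr w)) (rate j);
  arr_indep :
    independent_processes arr_law (fun j t w => arrivals_upto j t (arr w))
}.

Section Allocation.
Variables (R : realType) (inst : instance R).

(* dec k is the decision on the k-th arrival (from 0): Some i to serve it with
   offline agent i, None to reject it. *)
Definition load (dec : nat -> option (offline inst)) (k : nat)
    (i : offline inst) : nat :=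
  count (fun l => dec l == Some i) (iota 0 k).

Definition can_serve (dec : nat -> option (offline inst)) (k : nat)
    (i : offline inst) (j : types inst) : bool :=
  eligible i j && (load dec k i < cap i)%N.

Definition arrival_type (a : realization R (types inst)) (k : 'I_(size a)) :
    types inst := (tnth (in_tuple a) k).2.

(* A randomized allocation algorithm: alloc u a k is the decision on the k-th
   arrival of realization a when the internal random seed is u. A priori every
   decision may depend on the whole of a, so these are the clairvoyant
   algorithms. The measurability condition says that, once the number and the
   types of the arrivals are fixed, each decision is a measurable function of
   the seed and of the arrival times. *)
Record algorithm := Algorithm {
  seed_disp : measure_display;
  seed : measurableType seed_disp;
  seed_law : probability seed R;
  alloc : seed -> realization R (types inst) -> nat -> option (offline inst);
  alloc_feasible : forall u a (k : 'I_(size a)) i, valid a ->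
    alloc u a k = Some i -> can_serve (alloc u a) k i (arrival_type k);
  alloc_measurable : forall (m : nat) (js : m.-tuple (types inst)) (k : 'I_m) i,
    measurable [set x : (seed * m.-tuple R)%type |
      valid (zip x.2 js) /\ alloc x.1 (zip x.2 js) k = Some i]
}.

(* The decision on an arrival depends only on the seed and on the arrivals seen
   so far, the current one included. *)
Definition online (A : algorithm) : Prop :=
  forall u a a' (k : nat), valid a -> valid a' ->
    (k < size a)%N -> (k < size a')%N -> take k.+1 a = take k.+1 a' ->
    @alloc A u a k = alloc u a' k.

Definition nonrejecting (A : algorithm) : Prop :=
  forall (u : seed A) a (k : 'I_(size a)) i, valid a ->
    can_serve (alloc u a) k i (arrival_type k) -> alloc u a k <> None.

Definition served (A : algorithm) (j : types inst) (u : seed A)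
    (a : realization R (types inst)) : nat :=
  \sum_(k < size a | arrival_type k == j) (alloc u a k != None).

Variable M : arrival_model inst.

(* The seed is independent of the arrivals: the expectation is taken under the
   product law. *)
Definition expected_served (A : algorithm) (j : types inst) : \bar R :=
  'E_((seed_law A \x arr_law M)%E)[fun x => (served j x.1 (arr x.2))%:R].

Definition long_run_fairness (A : algorithm) : \bar R :=
  (\big[mine/+oo]_(j : types inst) (expected_served A j * (rate j)^-1%:E))%E.

Definition clairvoyant_opt : \bar R :=
  ereal_sup [set f | exists A : algorithm, f = long_run_fairness A].

End Allocation.

(* c-competitiveness on the class of instances (inst k) indexed by k : K. *)
Definition competitive (R : realType) (K : Type) (inst : K -> instance R)
    (M : forall k, arrival_model (inst k)) (A : forall k, algorithm (inst k))
    (c : R) : Prop :=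
  forall k, (c%:E * clairvoyant_opt (M k) <= long_run_fairness (M k) (A k))%E.

Section Hub.
Variables (R : realType) (n : nat) (n_ge2 : (2 <= n)%N).

(* Offline agent t in {1, ..., n} is the ordinal of value t - 1 in 'I_n, so that
   its own type t is lift ord0 of it; type 0 is ord0. *)
Definition hub_eligible (i : 'I_n) (j : 'I_n.+1) : bool :=
  (j == lift ord0 i) || (j == ord0).

Definition hub_rate (j : 'I_n.+1) : R :=
  if j == ord0 then n%:R - 1 else n%:R^-1.

Lemma hub_rate_gt0 j : 0 < hub_rate j.
Proof.
rewrite /hub_rate; case: ifP => _; first by rewrite subr_gt0 ltr1n.
by rewrite invr_gt0 ltr0n (leq_trans _ n_ge2).
Qed.

Definition hub_instance : instance R :=
  @Instance R 'I_n 'I_n.+1 hub_eligible (fun=> 1%N) hub_rate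
    (fun=> isT) hub_rate_gt0.

End Hub.

Definition hub_family (R : realType) (k : {n : nat | (2 <= n)%N}) : instance R :=
  hub_instance R (svalP k).

(* Main.v *)
(* With n = q ^ 2 agents, the fairness of a non-rejecting online algorithm is at
   most the sum over i of the expected number of own-type arrivals served by
   agent i, since these types all have rate 1 / n. Agent i serves an own-type
   arrival only if it is still free, and whether it is free at time s depends on
   the seed and on the arrivals up to s, hence is independent of the later
   arrivals. An algorithm that does not reject uses up an agent for every hub
   arrival while some agent is free, so at most (n - N_0(s))^+ agents are free at
   time s, about n (1 - s) in expectation; integrating over s gives
   1 / 2 + O(1 / q). A clairvoyant algorithm instead keeps agent i for its own
   type exactly when an arrival of that type is going to occur, and achieves
   fairness 1 - O(1 / q). *)
Require Import Defs.
From mathcomp Require Import all_boot all_order all_algebra.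
From mathcomp Require Import all_classical all_reals all_analysis.
From mathcomp Require Import measurable_realfun zify ring lra.

Set Implicit Arguments.
Unset Strict Implicit.
Unset Printing Implicit Defensive.

Import Order.TTheory GRing.Theory Num.Theory.
Import numFieldNormedType.Exports.

Local Open Scope classical_set_scope.
Local Open Scope ring_scope.

(** * Countably valued random variables *)

(** The model gives independence only through finite-dimensional marginals of the counting
    processes, while the event that an agent is free at time [s] depends on exact arrival times. Two
    facts bridge the gap. A pi-lambda argument carries independence of a later increment from
    finitely observed events to the sigma-algebra they generate. Freeness, jointly with the seed, is
    measurable for that sigma-algebra, because the times and types of the past can be recovered from
    countably many counts. The integral over [s] is replaced by a finite sum over cells of the
    horizon: an agent that serves an own-type arrival inside a cell is free at the left end of that
    cell. Independence is thus invoked only at deterministic times, and [n] cells cost only O(1 /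
    n). With [n = q ^ 2] the standard deviation of the hub arrivals is at most [q], so all error
    terms are rational functions of [q]. *)

Section CountableVariables.
Context (R : realType) (d : measure_display) (T : measurableType d).
Variable P : probability T R.
Implicit Types (D : set T).

Lemma countable_preimage_measurable (V : countType) (X : T -> V) (B : set V) :
  (forall v, measurable [set w | X w = v]) -> measurable (X @^-1` B).
Proof.
move=> mX; have -> : X @^-1` B = \bigcup_(v : V) ([set w | X w = v /\ B v]).
  by apply/seteqP; split => [w Bw|w [v _ [<-]]//]; exists (X w).
apply: countable_bigcupT_measurable; first exact: countableP.
move=> v; have [Bv|nBv] := pselect (B v).
  by rewrite (_ : [set w | _] = [set w | X w = v])//; apply/seteqP; split => w // [].
by rewrite (_ : [set w | _] = set0)//; apply/seteqP; split => w // [].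
Qed.

(** Lifts independence from single values of [X] to arbitrary events about [X]: the preimage is cut
    into countably many pieces, indexed by [pickle], each empty or a single level set. *)
Lemma proportional_preimage (V : countType) (X : T -> V) D (c : R) :
  (forall v, measurable [set w | X w = v]) -> measurable D ->
  (forall v, P ([set w | X w = v] `&` D) = P [set w | X w = v] * c%:E)%E ->
  forall B : set V, (P (X @^-1` B `&` D) = P (X @^-1` B) * c%:E)%E.
Proof.
move=> mX mD XD B.
pose F i := X @^-1` [set v | B v /\ pickle v = i].
have FE : X @^-1` B = \bigcup_i F i.
  by apply/seteqP; split => [w Bw|w [i _ []]//]; exists (pickle (X w)).
have mF i : measurable (F i) by exact: countable_preimage_measurable.
have tF : trivIset setT F.
  by move=> i j _ _ [w [[_ <-] [_ <-]]].
have FD i : P (F i `&` D) = (P (F i) * c%:E)%E.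
  have [[v [Bv vi]]|nv] := pselect (exists v, B v /\ pickle v = i).
    have -> : F i = [set w | X w = v]; last exact: XD.
    apply/seteqP; split=> [w /= [_ wi]|w /= wv]; last by rewrite /F /= wv.
    by apply: (pcan_inj pickleK); rewrite wi vi.
  have -> : F i = set0 by apply/seteqP; split=> // w [Bw wi]; apply: nv; exists (X w).
  by rewrite set0I measure0 mul0e.
rewrite FE setI_bigcupl !measure_bigcup//; first last.
  - by apply: trivIset_setIr.
  - by move=> i _; exact: measurableI.
rewrite (eq_eseriesr (g := fun i => c%:E * P (F i))%E); last first.
  by move=> i _; rewrite muleC; exact: FD.
by rewrite nneseriesZl// muleC.
Qed.

Lemma measurable_countable_comp (V : countType) (X : T -> V) (f : V -> R) :
  (forall v, measurable [set w | X w = v]) ->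
  measurable_fun [set: T] (fun w => f (X w)).
Proof.
move=> mX _ B _; rewrite setTI.
exact: (countable_preimage_measurable (f @^-1` B) mX).
Qed.

Lemma ge0_integral_natvalued (X : T -> nat) (f : nat -> R) D :
  (forall k, measurable [set w | X w = k]) -> measurable D ->
  (forall k, 0 <= f k) ->
  (\int[P]_(w in D) (f (X w))%:E =
   \sum_(k <oo) (f k)%:E * P (D `&` [set w | X w = k]))%E.
Proof.
move=> mX mD f0.
have DE : D = \bigcup_k (D `&` [set w | X w = k]).
  by apply/seteqP; split=> [w Dw|w [k _ []]//]; exists (X w).
have mF k : measurable (D `&` [set w | X w = k]) by exact: measurableI.
rewrite {1}DE ge0_integral_bigcup//.
- apply: eq_eseriesr => k _.
  rewrite (eq_integral (cst (f k)%:E)) ?integral_cst// => w.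
  by rewrite inE => -[_ /= ->].
- rewrite -DE; apply/measurable_EFinP; apply: measurable_funTS.
  exact: measurable_countable_comp.
- by move=> w _; rewrite lee_fin.
- by move=> i j _ _ [w [[_ <-] [_ <-]]].
Qed.

Lemma probability_integral_cst (r : R) : (\int[P]__ r%:E = r%:E)%E.
Proof.
by rewrite integral_cst// -[RHS]mule1; congr (_ * _)%E; exact: probability_setT.
Qed.

Lemma integral_snd dU (U : measurableType dU) (Q : probability U R)
    (f : T -> \bar R) : measurable_fun [set: T] f -> (forall w, 0 <= f w)%E ->
  (\int[(Q \x P)%E]_x f x.2 = \int[P]_w f w)%E.
Proof.
move=> mf f0; rewrite fubini_tonelli1//; last first.
  by apply: (measurableT_comp mf); exact: measurable_snd.
rewrite /fubini_F/= integral_cst// -[RHS]mule1; congr (_ * _)%E.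
exact: probability_setT.
Qed.

Section PoissonMoments.
Variables (X : T -> nat) (lam : R).
Hypotheses (lam0 : 0 < lam) (mX : forall k, measurable [set w | X w = k]).
Hypothesis XP : forall k, P [set w | X w = k] = (poisson_pmf lam k)%:E.

(** The Chen-Stein identity, from [k p(k) = lam p(k - 1)] for the Poisson weights [p]. Constant [f]
    yields the mean, the identity the second moment. *)
Lemma poisson_shift (f : nat -> R) : (forall k, 0 <= f k) ->
  (\int[P]_w ((X w)%:R * f (X w))%:E = lam%:E * \int[P]_w (f (X w).+1)%:E)%E.
Proof.
move=> f0.
rewrite (@ge0_integral_natvalued X (fun k => k%:R * f k))//; last first.
  by move=> k; rewrite mulr_ge0.
rewrite (@ge0_integral_natvalued X (fun k => f k.+1))//.
rewrite nneseries_recl//; last by move=> k _; rewrite mule_ge0// lee_fin mulr_ge0.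
rewrite mul0r mul0e add0e -nneseries_addn; last first.
  by move=> k; rewrite mule_ge0// lee_fin mulr_ge0.
rewrite -nneseriesZl//; last by move=> k _; rewrite mule_ge0// lee_fin.
apply: eq_eseriesr => k _; rewrite !setTI addn1 !XP -!EFinM; congr EFin.
rewrite /poisson_pmf lam0 factS natrM exprS invfM.
have k0 : k.+1%:R != 0 :> R by rewrite pnatr_eq0.
have kf : k`!%:R != 0 :> R by rewrite pnatr_eq0 -lt0n fact_gt0.
by field; rewrite ?nmulrn; apply/andP; split=> //; rewrite nat1r.
Qed.

Lemma poisson_mean : (\int[P]_w ((X w)%:R)%:E = lam%:E)%E.
Proof.
under eq_integral do rewrite -[_%:R]mulr1.
by rewrite (poisson_shift (f := fun=> 1))// (probability_integral_cst 1) mule1.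
Qed.

Lemma poisson_moment2 : (\int[P]_w ((X w)%:R ^+ 2)%:E = (lam ^+ 2 + lam)%:E)%E.
Proof.
under eq_integral do rewrite expr2.
rewrite (poisson_shift (f := fun k => k%:R))//.
under eq_integral do rewrite -natr1 EFinD.
rewrite ge0_integralD//.
- by rewrite poisson_mean (probability_integral_cst 1) -EFinD -EFinM
    mulrDr mulr1.
by apply/measurable_EFinP; exact: measurable_countable_comp.
Qed.

End PoissonMoments.
End CountableVariables.

(** * Independence of the past and the increments *)

Section IndependentIncrements.
Context (R : realType) (d : measure_display) (T : measurableType d).
Variables (P : probability T R) (J : finType) (N : J -> R -> T -> nat).
Variable rate : J -> R.
Hypothesis N_poisson : forall j, poisson_process P (N j) (rate j).
Hypothesis N_indep : independent_processes P N.

Lemma process0 j w : N j 0 w = 0%N.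
Proof. by have [_ /(_ w)[]] := N_poisson j. Qed.

Lemma process_mono j w s t : 0 <= s -> s <= t -> t <= 1 -> (N j s w <= N j t w)%N.
Proof.
have [_ /(_ w)[_ Nw] _ _] := N_poisson j.
move=> s0 st t1; apply: Nw => //.
  by rewrite in_itv/= s0 (le_trans st).
by rewrite in_itv/= t1 (le_trans s0).
Qed.

Lemma measurable_process j t k : 0 <= t <= 1 -> measurable [set w | N j t w = k].
Proof.
have [/(_ t) mN _ _ _] := N_poisson j => /mN{}mN.
by rewrite -[X in measurable X]setTI; exact: (mN measurableT [set k]).
Qed.

Lemma measurable_increment j s t k : 0 <= s <= 1 -> 0 <= t <= 1 ->
  measurable [set w | (N j t w - N j s w)%N = k].
Proof.
move=> s01 t01.
pose X w := (N j s w, N j t w).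
rewrite (_ : [set w | _] = X @^-1` [set x | (x.2 - x.1)%N = k])//.
apply: countable_preimage_measurable => -[a b].
rewrite (_ : [set w | _] = [set w | N j s w = a] `&` [set w | N j t w = b]).
  by apply: measurableI; exact: measurable_process.
by apply/seteqP; split => [w [<- <-]//|w [/= <- <-]].
Qed.

(** The grid starts at 0, where the counts vanish, so prescribing increments is prescribing values.
    Independence of the processes then separates the types, and independence of increments separates
    the cells of one type. *)
Lemma increments_independent (p : nat) (t : nat -> R) (x : J -> nat -> nat) :
  t 0%N = 0 -> t p <= 1 -> (forall l, (l < p)%N -> t l < t l.+1) ->
  P [set w | forall j (l : 'I_p), (N j (t l.+1) w - N j (t l) w)%N = x j l] =
  (\prod_j \prod_(l < p)
     P [set w | (N j (t l.+1) w - N j (t l) w)%N = x j l])%E.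
Proof.
move=> t0 tp tS.
have tmono a b : (a <= b)%N -> (b <= p)%N -> t a <= t b.
  elim: b => [|b IHb]; first by rewrite leqn0 => /eqP->.
  rewrite leq_eqVlt => /predU1P[->//|ab] bp.
  by rewrite (le_trans (IHb ab (ltnW bp)))// ltW// tS.
have t01 l : (l <= p)%N -> 0 <= t l <= 1.
  by move=> lp; rewrite -{1}t0 tmono//= (le_trans _ tp)// tmono.
pose c j l := (\sum_(i < l) x j i)%N.
have incE j : [set w | forall l : 'I_p, (N j (t l.+1) w - N j (t l) w)%N = x j l] =
    [set w | [tuple N j (t l) w | l < p.+1] = [tuple c j l | l < p.+1]].
  apply/seteqP; split=> w /= H.
    apply: eq_from_tnth => -[l lp]; rewrite !tnth_mktuple/=.
    elim: l lp => [|l IHl] lp; first by rewrite t0 process0 /c big_ord0.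
    have := H (Ordinal (lp : (l < p)%N)); rewrite /c big_ord_recr/= -/(c j l).
    rewrite -(IHl (ltnW lp)) => <-; rewrite addnC subnK//.
    have /andP[? _] := t01 l (ltnW lp); have /andP[_ ?] := t01 l.+1 lp.
    by apply: process_mono => //; exact: tmono.
  move=> l.
  have Hl i (ip : (i < p.+1)%N) : N j (t i) w = c j i.
    by have := congr1 (fun u => tnth u (Ordinal ip)) H; rewrite !tnth_mktuple.
  by rewrite !Hl ?ltnS ?(ltnW (ltn_ord l))// /c big_ord_recr/= addnC addnK.
have t01' (l : 'I_p.+1) : 0 <= t l <= 1 by apply: t01; rewrite -ltnS.
have := N_indep t01' (fun j => [tuple c j l | l < p.+1]).
rewrite (_ : [set w | forall k, _] =
  [set w | forall j (l : 'I_p), (N j (t l.+1) w - N j (t l) w)%N = x j l]); last first.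
  apply/seteqP; split=> w /= H j.
    by have : [set w | [tuple N j (t l) w | l < p.+1] = [tuple c j l | l < p.+1]] w
      := H j; rewrite -incE.
  have : [set w | forall l : 'I_p, (N j (t l.+1) w - N j (t l) w)%N = x j l] w
      := H j.
  by rewrite incE.
move=> ->; apply: eq_bigr => j _; rewrite -incE.
have [_ _ /(_ p t) incr _] := N_poisson j.
by apply: (incr _ tp tS (fun l : 'I_p => x j l)); rewrite t0.
Qed.

Definition determined_by (ts : seq R) (B : set T) :=
  forall w w', (forall j t, t \in ts -> N j t w = N j t w') -> B w -> B w'.

(* The events depending on finitely many values of the processes before time s:
   a pi-system generating the information available at time s. *)
Definition history (s : R) : set (set T) :=
  [set B | exists2 ts, all (fun t => 0 <= t <= s) ts & determined_by ts B].

Lemma history_setI_closed s : setI_closed (history s).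
Proof.
move=> B C [tB tB0 dB] [tC tC0 dC]; exists (tB ++ tC).
  by rewrite all_cat tB0.
move=> w w' ww' [Bw Cw]; split.
- by apply: dB Bw => j t tt; apply: ww'; rewrite mem_cat tt.
- by apply: dC Cw => j t tt; apply: ww'; rewrite mem_cat tt orbT.
Qed.

(** Such an event is a preimage under a finite family of natural-number counts, and every set of
    such families is countable. *)
Lemma history_measurable s B : s <= 1 -> history s B -> measurable B.
Proof.
move=> s1 [ts ts0 dB].
pose X w := [ffun x : J * 'I_(size ts) => N x.1 (ts`_x.2) w].
rewrite (_ : B = X @^-1` (X @` B)); last first.
  apply/seteqP; split=> [w Bw|w' [w Bw ww']]; first by exists w.
  apply: dB Bw => j t tt.
  rewrite -index_mem in tt.
  have := congr1 (fun f : {ffun _} => f (j, Ordinal tt)) ww'.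
  by rewrite !ffunE/= nth_index// -index_mem.
apply: countable_preimage_measurable => v.
rewrite (_ : [set w | _] =
  \bigcap_(x : J * 'I_(size ts)) [set w | N x.1 (ts`_x.2) w = v x]).
  apply: fin_bigcap_measurable => // x _; apply: measurable_process.
  have /allP/(_ (ts`_x.2)) := ts0; rewrite mem_nth// => /(_ isT)/andP[-> ?].
  by rewrite (le_trans _ s1).
apply/seteqP; split=> [w /= <- x _|w H]; first by rewrite ffunE.
by apply/ffunP => x; rewrite ffunE; exact: H.
Qed.

Lemma history_increment_indep s s' B j k : 0 <= s -> s < s' -> s' <= 1 ->
  history s B ->
  (P (B `&` [set w | (N j s' w - N j s w)%N = k]) =
   P B * P [set w | (N j s' w - N j s w)%N = k])%E.
Proof.
move=> s0 ss' s'1 hB.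
have s1 : s <= 1 by rewrite (le_trans (ltW ss')).
have mB := history_measurable s1 hB.
case: hB => ts tss dB.
(* The increments over the grid g followed by s' are independent, and those
   over g alone determine B. *)
pose g := sort <=%R (undup (0 :: s :: ts)).
have gE x : (x \in g) = (x \in 0 :: s :: ts) by rewrite mem_sort mem_undup.
have g_sorted : sorted <%R g by rewrite sort_lt_sorted undup_uniq.
have gs x : x \in g -> 0 <= x <= s.
  rewrite gE !inE => /or3P[/eqP->|/eqP->|xts]; rewrite ?lexx ?s0//.
  by have /allP := tss; exact.
have size_g : (0 < size g)%N by have := gE 0; rewrite mem_head; case: (g).
pose p := (size g).-1.
have sg : size g = p.+1 by rewrite prednK.
have gmono a b : (a <= b)%N -> (b < size g)%N -> nth s' g a <= nth s' g b.
  move=> ab bg; apply: (sorted_leq_nth le_trans le_refl) => //.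
  - by rewrite sort_sorted//; exact: le_total.
  - by rewrite inE (leq_ltn_trans ab).
(* The default value of [nth] appends [s'] to the grid: [t p] is [s] and [t p.+1] is [s']. *)
pose t := nth s' g.
have t0 : t 0%N = 0.
  have /andP[t0 _] := gs (t 0%N) (mem_nth _ size_g).
  apply/eqP; rewrite eq_le t0 andbT.
  have g0 : 0 \in g by rewrite gE mem_head.
  by rewrite -[leRHS](nth_index s' g0) gmono// index_mem.
have tp : t p = s.
  have pg : (p < size g)%N by rewrite sg.
  have /andP[_ tp] := gs (t p) (mem_nth _ pg).
  apply/eqP; rewrite eq_le tp/=.
  have gs' : s \in g by rewrite gE !inE eqxx orbT.
  rewrite -[leLHS](nth_index s' gs') gmono//.
  by rewrite -ltnS -sg index_mem.
have tp1 : t p.+1 = s' by rewrite /t nth_default// sg.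
have tS l : (l < p.+1)%N -> t l < t l.+1.
  rewrite ltnS leq_eqVlt => /predU1P[->|lp]; first by rewrite tp tp1.
  apply: (sorted_ltn_nth lt_trans) => //; rewrite inE sg ltnS// ltnW//.
pose inc j l w := (N j (t l.+1) w - N j (t l) w)%N.
have t01 l : (l <= p.+1)%N -> 0 <= t l <= 1.
  rewrite leq_eqVlt => /predU1P[->|lp].
    by rewrite tp1 s'1 (le_trans s0)// ltW.
  have /gs/andP[-> ?] : t l \in g by rewrite mem_nth// sg.
  by rewrite (le_trans _ s1).
have minc j' l x : (l < p.+1)%N -> measurable [set w | inc j' l w = x].
  by move=> lp; apply: measurable_increment; apply: t01 => //; exact: ltnW.
(* [X] gathers the increments up to [s], and [Y] those of the last cell, from [s] to [s']. *)
pose X w := [ffun x : J * 'I_p => inc x.1 x.2 w].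
pose Y w := [ffun j' : J => inc j' p w].
have mX v : measurable [set w | X w = v].
  rewrite (_ : [set w | _] = \bigcap_(x : J * 'I_p) [set w | inc x.1 x.2 w = v x]).
    by apply: fin_bigcap_measurable => // x _; apply: minc; rewrite ltnW// ltnS.
  apply/seteqP; split=> [w /= <- x _|w H]; first by rewrite ffunE.
  by apply/ffunP => x; rewrite ffunE; exact: H.
have mY v : measurable [set w | Y w = v].
  rewrite (_ : [set w | _] = \bigcap_(x : J) [set w | inc x p w = v x]).
    by apply: fin_bigcap_measurable => // x _; apply: minc.
  apply/seteqP; split=> [w /= <- x _|w H]; first by rewrite ffunE.
  by apply/ffunP => x; rewrite ffunE; exact: H.
have PXY v y : P ([set w | X w = v] `&` [set w | Y w = y]) =
    (P [set w | X w = v] * (fine (\prod_j' P [set w | inc j' p w = y j']))%:E)%E.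
  pose x j' l := if insub l is Some l' then v (j', l') else y j'.
  have xp j' : x j' p = y j' by rewrite /x insubF// ltnn.
  have xl j' (l : 'I_p) : x j' l = v (j', l).
    rewrite /x; case: insubP => [l' _ ll'|]; last by rewrite ltn_ord.
    by congr (v (_, _)); exact: val_inj.
  have tp1' : t p.+1 <= 1 by rewrite tp1.
  have := increments_independent x t0 tp1' tS.
  rewrite (_ : [set w | _] = [set w | X w = v] `&` [set w | Y w = y]); last first.
    apply/seteqP; split=> [w H|w [/= Xw Yw] j' l].
      split; [apply/ffunP => -[j' l]|apply/ffunP => j']; rewrite ffunE/=.
        by rewrite -xl -(H j' (widen_ord (leqnSn p) l)).
      by rewrite -xp -(H j' ord_max).
    have [lp|] := boolP (l < p)%N.
      by rewrite -[x j' l]/(x j' (Ordinal lp)) xl -Xw ffunE.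
    rewrite -leqNgt => pl.
    have -> : l = p :> nat by apply/eqP; rewrite eqn_leq pl -ltnS ltn_ord.
    by rewrite xp -Yw ffunE.
  move=> ->.
  have tp' : t p <= 1 by rewrite tp.
  have := increments_independent x t0 tp' (fun l lp => tS l (ltnW lp)).
  rewrite (_ : [set w | _] = [set w | X w = v]); last first.
    apply/seteqP; split=> [w H|w /= Xw j' l]; last by rewrite xl -Xw ffunE.
    by apply/ffunP => -[j' l]; rewrite ffunE/= -xl -H.
  move=> ->; rewrite fineK; last first.
    by apply: prode_fin_num => j' _; apply: fin_num_measure; exact: minc.
  rewrite -big_split/=; apply: eq_bigr => j' _; rewrite big_ord_recr/= xp.
  by [].
(* [proportional_preimage] is applied first to [X] with the event [Y = y], which reaches [B], and
   later to [Y] with the event [B]. Taking [setT] in the first application identifies its factor as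
   the probability of [Y = y]. *)
have Bindep y : (P ([set w | Y w = y] `&` B) =
    P [set w | Y w = y] * (fine (P B))%:E)%E.
  have XE : B = X @^-1` (X @` B).
    apply/seteqP; split=> [w Bw|w' [w Bw ww']]; first by exists w.
    apply: dB Bw => j' u uts.
    have tE l : (l < p.+1)%N -> N j' (t l) w = N j' (t l) w'.
      elim: l => [_|l IHl lp]; first by rewrite t0 !process0.
      have := congr1 (fun f : {ffun _} => f (j', Ordinal (lp : (l < p)%N))) ww'.
      rewrite !ffunE/= /inc => incE.
      have mono w0 : (N j' (t l) w0 <= N j' (t l.+1) w0)%N.
        have /andP[? _] := t01 l (ltnW (ltnW lp)); have /andP[_ ?] := t01 l.+1 (ltnW lp).
        by apply: process_mono => //; rewrite ltW// tS// ltnW.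
      by rewrite -(subnK (mono w)) -(subnK (mono w')) incE IHl// ltnW.
    have ug : u \in g by rewrite gE !inE uts !orbT.
    by rewrite -(nth_index s' ug); apply: tE; rewrite -sg index_mem.
  have XB := proportional_preimage mX (mY y) (PXY^~ y).
  rewrite fineK; last exact: fin_num_measure.
  rewrite setIC [in LHS]XE XB -XE muleC; congr (_ * _)%E.
  by have := XB setT; rewrite preimage_setT setTI probability_setT mul1e.
rewrite setIC.
have -> : [set w | (N j s' w - N j s w)%N = k] = Y @^-1` [set y | y j = k].
  by apply/seteqP; split=> w /=; rewrite ffunE /inc tp tp1.
rewrite (proportional_preimage mY mB Bindep) muleC fineK//.
exact: fin_num_measure.
Qed.

End IndependentIncrements.

(** * Independence of later increments from the full past and the seed *)

Section HistorySigmaAlgebra.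
Context (R : realType) (d : measure_display) (T : measurableType d).
Variables (P : probability T R) (J : finType) (N : J -> R -> T -> nat).
Variable rate : J -> R.
Hypothesis rate_gt0 : forall j, 0 < rate j.
Hypothesis N_poisson : forall j, poisson_process P (N j) (rate j).
Hypothesis N_indep : independent_processes P N.
Variables (s s' : R) (j : J).
Hypotheses (s0 : 0 <= s) (ss' : s < s') (s'1 : s' <= 1).

Local Notation H := (history N s).
Local Notation Delta := (fun w => N j s' w - N j s w)%N.

Let s1 : s <= 1. Proof. by rewrite (le_trans (ltW ss')). Qed.

Let mDelta k : measurable [set w | Delta w = k].
Proof.
by apply: (measurable_increment N_poisson);
  rewrite ?s0 ?s1 ?s'1 ?(le_trans s0)// ltW.
Qed.

(** Dynkin induction from the pi-system [H]. Measurability of [B] is carried in the induction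
    predicate, since additivity of [P] is used in the complement and union steps. *)
Lemma sigma_history_increment_indep B k : <<s H >> B ->
  measurable B /\
  (P (B `&` [set w | Delta w = k]) = P B * P [set w | Delta w = k])%E.
Proof.
set D := [set w | _].
have PDE : P D = (fine (P D))%:E.
  by rewrite fineK//; apply: fin_num_measure; exact: mDelta.
apply: (@dynkin_induction _ (g_sigma_algebraType H) H
  (fun B => measurable (B : set T) /\ (P ((B : set T) `&` D) = P B * P D)%E)) => //.
- exact: history_setI_closed.
- by split=> //; rewrite setTI [X in _ = (X * _)%E]probability_setT mul1e.
- move=> A hA; split; first exact: (history_measurable N_poisson _ hA).
  exact: (history_increment_indep N_poisson N_indep).
- suff C (A : set T) : measurable A -> P (A `&` D) = (P A * P D)%E ->
      P (~` A `&` D) = (P (~` A) * P D)%E.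
    by move=> A _ [mA AD]; split; [exact: measurableC|exact: C].
  move=> mA AD.
  have DI : (P D = P (~` A `&` D) + P D * P A)%E.
    rewrite [(P D * _)%E]muleC -AD setIC [A `&` D]setIC -setDE.
    by apply: measureDI; first exact: mDelta.
  have mAD : measurable (~` A `&` D).
    by apply: measurableI; [exact: measurableC|exact: mDelta].
  have CA := probability_setC P mA.
  have : P (~` A) \is a fin_num by apply: fin_num_measure; exact: measurableC.
  have : P (~` A `&` D) \is a fin_num by exact: fin_num_measure.
  have : P A \is a fin_num by exact: fin_num_measure.
  move: DI CA; rewrite PDE; case: (P A) => [a| |] //.
  case: (P (~` A `&` D)) => [b| |] // + + _ _; case: (P (~` A)) => [c| |]// + + _.
  rewrite -!EFinM -!EFinD => -[] E [] ->; congr EFin.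
  by rewrite mulrBl mul1r [in X in X - _]E mulrC [in X in _ - X]mulrC; lra.
- move=> F _ tF PF; split; first by apply: bigcupT_measurable => n; case: (PF n).
  rewrite setI_bigcupl !measure_bigcup//; first last.
  - by apply: trivIset_setIr.
  - by move=> i _; apply: measurableI; [case: (PF i)|exact: mDelta].
  - by move=> i _; case: (PF i).
  rewrite (eq_eseriesr (g := fun i => P D * P (F i))%E); last first.
    by move=> i _; rewrite muleC; case: (PF i).
  by rewrite PDE nneseriesZl// muleC.
Qed.

Lemma sigma_history_increment_mean B : <<s H >> B ->
  (\int[P]_(w in B) ((Delta w)%:R)%:E = P B * (rate j * (s' - s))%:E)%E.
Proof.
move=> hB; have [mB _] := sigma_history_increment_indep 0 hB.
have incP k : P [set w | Delta w = k] = (poisson_pmf (rate j * (s' - s)) k)%:E.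
  by have [_ _ _ /(_ s s' s0 ss' s'1)] := N_poisson j; apply.
rewrite (@ge0_integral_natvalued _ _ _ P (fun w => Delta w) (fun k => k%:R))//.
have PBE : P B = (fine (P B))%:E by rewrite fineK//; exact: fin_num_measure.
rewrite (eq_eseriesr (g := fun k =>
  P B * (k%:R%:E * P ([set: T] `&` [set w | Delta w = k])))%E); last first.
  by move=> k _; rewrite setTI (sigma_history_increment_indep k hB).2 muleCA.
rewrite PBE nneseriesZl//; last by move=> k _; rewrite mule_ge0// lee_fin.
rewrite -(@ge0_integral_natvalued _ _ _ P (fun w => Delta w) (fun k => k%:R))//.
by rewrite (poisson_mean _ mDelta incP)// mulr_gt0// subr_gt0.
Qed.

Section Product.
Context (dU : measure_display) (U : measurableType dU) (Q : probability U R).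
Variable F : set (U * T).
Hypothesis mF : measurable (F : set (U * g_sigma_algebraType H)).

(** The identity map onto the product with the coarser sigma-algebra of the past is measurable. *)
Lemma measurable_history_prod : measurable F.
Proof.
have mid : measurable_fun [set: U * T]
    ((fun x => (x.1, x.2)) : U * T -> U * g_sigma_algebraType H).
  apply/measurable_fun_pair => /=; first exact: measurable_fst.
  move=> _ B hB; rewrite setTI.
  rewrite (_ : _ @^-1` B = setT `*` (B : set T)); last first.
    by apply/seteqP; split=> [x Bx|x []//].
  by apply: measurableX => //; case: (sigma_history_increment_indep 0 hB).
have := mid measurableT F mF; rewrite setTI.
by rewrite (_ : _ @^-1` F = F)//; apply/seteqP; split=> -[].
Qed.

(** For each fixed seed the section of [F] is an event of the past, so the single-space identity
    applies to it; Tonelli then integrates over the seed. *)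
Lemma product_history_increment_mean :
  (\int[(Q \x P)%E]_x (\1_F x * (Delta x.2)%:R)%:E =
   (Q \x P) F * (rate j * (s' - s))%:E)%E.
Proof.
have mD : measurable_fun [set: U * T] (fun x => (Delta x.2)%:R : R).
  apply: (@measurableT_comp _ _ _ _ _ _ (fun w => (Delta w)%:R : R)) => //.
  exact: (@measurable_countable_comp _ _ _ _ (fun w => Delta w) (fun k => k%:R)).
have mFU := measurable_history_prod.
rewrite fubini_tonelli1//; last first.
  by apply/measurable_EFinP; apply: measurable_funM => //; exact: measurable_indic.
rewrite /product_measure1/= -ge0_integralZr//; first last.
- by rewrite lee_fin mulr_ge0// ?ltW// subr_gt0.
- exact: measurable_fun_xsection.
apply: eq_integral => u _; rewrite /fubini_F/=.
rewrite -sigma_history_increment_mean; last first.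
  exact: (@measurable_xsection _ _ U (g_sigma_algebraType H) F u mF).
rewrite [RHS]integral_mkcond; apply: eq_integral => w _.
rewrite patchE indicE mem_xsection; case: ifP => _; last by rewrite mul0r.
by rewrite mul1r.
Qed.

End Product.
End HistorySigmaAlgebra.

(** * Realizations and their truncations *)

Section Realizations.
Context (R : realType) (J : finType).
Implicit Types (a : realization R J) (j : J) (s t : R) (l : nat).

Definition upto s a : realization R J := [seq x <- a | x.1 <= s].

(** Chronological order turns a filter by time into a prefix. This links time [s] to the condition
    [online], which is phrased with [take]. *)
Lemma upto_take s a : valid a -> upto s a = take (size (upto s a)) a.
Proof.
case/andP => + _; rewrite /upto; elim: a => //= x a IHa xa.
have [xs|sx] := leP x.1 s; first by rewrite /= -IHa// (path_sorted xa).
rewrite (_ : [seq y <- a | y.1 <= s] = [::])//; apply/eqP; rewrite -[_ == _]negbK -has_filter.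
rewrite -all_predC; have := order_path_min lt_trans xa; rewrite all_map.
by apply: sub_all => y /= xy; rewrite -ltNge (lt_trans sx).
Qed.

Lemma upto_valid s a : valid a -> valid (upto s a).
Proof.
move=> va; case/andP: (va) => sa aa; apply/andP; split.
  by rewrite upto_take// map_take take_sorted.
by apply/allP => x; rewrite mem_filter => /andP[_ xa]; have /allP := aa; apply.
Qed.

Lemma arrivals_upto_upto j s t a :
  arrivals_upto j t (upto s a) = arrivals_upto j (Order.min t s) a.
Proof.
rewrite /arrivals_upto count_filter; apply: eq_count => x /=.
by rewrite le_min -andbA.
Qed.

Lemma size_upto s a : size (upto s a) = (\sum_j arrivals_upto j s a)%N.
Proof.
rewrite size_filter /arrivals_upto; under eq_bigr do rewrite -sum1_count big_mkcond/=.
rewrite exchange_big/= -sum1_count big_mkcond/=; apply: eq_bigr => x _.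
rewrite big_mkcond (bigD1 x.2)//= eqxx/= big1 ?addn0//.
by move=> j; rewrite eq_sym => /negbTE->.
Qed.

Lemma arrivals_upto_count j t a : valid a ->
  arrivals_upto j t a = count_mem j (take (size (upto t a)) (unzip2 a)).
Proof.
move=> va; rewrite /unzip2 -map_take -upto_take// count_map count_filter.
by apply: eq_count => x /=.
Qed.

Lemma nth_time_le s a l : valid a -> (l < size a)%N ->
  ((unzip1 a)`_l <= s) = (l < size (upto s a))%N.
Proof.
case/andP => + _; rewrite /upto; elim: a l => //= x a IHa l xa la.
have [xs|sx] := leP x.1 s.
  by case: l la => [|l] la //=; rewrite IHa// (path_sorted xa).
rewrite (_ : [seq y <- a | y.1 <= s] = [::]).
  rewrite ltn0; apply/negbTE; rewrite -ltNge; case: l la => //= l la.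
  have /allP := order_path_min lt_trans xa.
  move=> /(_ (unzip1 a)`_l); rewrite mem_nth ?size_map// => /(_ isT).
  exact: lt_trans.
apply/eqP; rewrite -[_ == _]negbK -has_filter.
rewrite -all_predC; have := order_path_min lt_trans xa; rewrite all_map.
by apply: sub_all => y /= xy; rewrite -ltNge (lt_trans sx).
Qed.

(** Arrival times increase strictly, so a rational lies between consecutive ones. At the two ends 0
    and 1 serve, as arrivals lie in the half-open interval from 0, excluded, to 1. *)
Lemma rational_separating_time a l : valid a -> (l <= size a)%N ->
  exists2 q : rat, 0 <= ratr q :> R & size (upto (ratr q) a) = l.
Proof.
move=> va; have /andP[sa /allP aa] := va.
have time01 i : (i < size a)%N -> 0 < (unzip1 a)`_i <= 1.
  move=> ia; have : (unzip1 a)`_i \in unzip1 a by rewrite mem_nth ?size_map.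
  by case/mapP => x /aa ? ->.
case: l => [_|l].
  exists 0; first by rewrite rmorph0.
  rewrite rmorph0 size_filter; apply/eqP; rewrite -leqn0 leqNgt -has_count.
  by rewrite -all_predC; apply/allP => x /aa /andP[x0 _] /=; rewrite -ltNge.
rewrite leq_eqVlt => /predU1P[la|la].
  exists 1; rewrite rmorph1// la size_filter; apply/eqP; rewrite -all_count.
  by apply/allP => x /aa /andP[].
have ltt : (unzip1 a)`_l < (unzip1 a)`_l.+1.
  by apply: (sorted_ltn_nth lt_trans) => //; rewrite inE size_map// ltnW.
have [q] := rat_in_itvoo ltt; rewrite in_itv/= => /andP[lq ql].
exists q; first by rewrite ltW// (lt_trans _ lq)//; case/andP: (time01 l (ltnW la)).
apply/eqP; rewrite eqn_leq -nth_time_le ?(ltW lq)//; last exact: ltnW.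
by rewrite andbT leqNgt -nth_time_le// -ltNge.
Qed.

(* Rational times suffice because arrivals are isolated; this exhibits the type
   of the l-th arrival as a countable combination of values of the counting
   processes. *)
Lemma nth_type_jump a l j : valid a ->
  onth (unzip2 a) l = Some j <->
  exists q q' : rat, [/\ 0 <= ratr q :> R, 0 <= ratr q' :> R,
    size (upto (ratr q) a) = l, size (upto (ratr q') a) = l.+1 &
    arrivals_upto j (ratr q') a = (arrivals_upto j (ratr q) a).+1].
Proof.
move=> va.
have cE t := arrivals_upto_count j t va.
split.
  move=> aj.
  have la : (l < size a)%N by rewrite -(size_map snd) -onthTE aj.
  have [q q0 ql] := rational_separating_time va (ltnW la).
  have [q' q'0 q'l] := rational_separating_time va la.
  exists q, q'; split=> //; rewrite !cE ql q'l.
  rewrite (take_nth j) ?size_map// -cats1 count_cat/= addn0.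
  have nj : nth j (unzip2 a) l = j by exact: onth_nth.
  by rewrite nj eqxx addn1.
case=> q [q' [q0 q'0 ql q'l]]; rewrite !cE ql q'l.
have la : (l < size a)%N.
  by rewrite -q'l; have := count_size (fun x => x.1 <= ratr q') a; rewrite size_filter.
rewrite (take_nth j) ?size_map// -cats1 count_cat/= addn0 => /eqP.
rewrite -addn1 eqn_add2l; case: (nth j (unzip2 a) l =P j) => // jE _.
by rewrite onthE (nth_map j) ?size_map// jE.
Qed.

End Realizations.

(** * Measurability of past decisions with respect to the observed counts *)

Section ObservedArrivals.
Context (R : realType) (inst : instance R) (M : arrival_model inst) (s : R).
Hypotheses (s0 : 0 <= s).

Local Notation N := (fun j t w => arrivals_upto j t (arr (a := M) w)).
Local Notation H := (history N s).
Local Notation past w := (upto s (arr (a := M) w)).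

Let past_valid w : valid (past w).
Proof. exact/upto_valid/arr_valid. Qed.

Lemma measurable_past_time l :
  measurable_fun [set: g_sigma_algebraType H] (fun w => (unzip1 (past w))`_l).
Proof.
apply: (measurability _ (RGenOInfty.measurableE R)) => _ [_ [x ->] <-].
rewrite setTI; apply: sub_sigma_algebra.
have time_ge0 w : 0 <= (unzip1 (past w))`_l.
  have [la|la] := ltnP l (size (past w)); last by rewrite nth_default ?size_map.
  have /andP[_ /allP aa] := past_valid w.
  have : (unzip1 (past w))`_l \in unzip1 (past w) by rewrite mem_nth ?size_map.
  by case/mapP => y /aa /andP[/ltW ? _] ->.
(* For negative [x] the event is everything, since the times and the default value 0 are
   nonnegative; [Order.min x s] would not be an admissible observation time. *)
have [x0|x0] := ltP x 0.
  exists [::] => // w w' _ _; rewrite /= in_itv/= andbT.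
  exact: lt_le_trans (time_ge0 w').
exists [:: Order.min x s; s]; first by rewrite /= le_min ge_min !lexx x0 s0 orbT.
move=> w w' ww' /=; rewrite !in_itv/= !andbT.
have size_past v : size (past v) = (\sum_j N j s v)%N by exact: size_upto.
(* Arrival [l] exists and comes after [x] exactly when more than [l] arrivals occur up to [s] but at
   most [l] up to [Order.min x s]. *)
have timeE v : (x < (unzip1 (past v))`_l) =
    (l < \sum_j N j s v)%N && (\sum_j N j (Order.min x s) v <= l)%N.
  have [lv|lv] := ltnP l (size (past v)); rewrite -size_past.
    rewrite lv ltNge nth_time_le// -leqNgt size_upto.
    by under eq_bigr do rewrite arrivals_upto_upto.
  by rewrite ltnNge lv/= nth_default ?size_map// ltNge x0.
have tE t : t \in [:: Order.min x s; s] -> (\sum_j N j t w = \sum_j N j t w')%N.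
  by move=> tt; apply: eq_bigr => j _; exact: ww'.
by rewrite !timeE !tE// ?mem_head// !inE eqxx orbT.
Qed.

Lemma measurable_past_type l (o : option (types inst)) :
  measurable ([set w | onth (unzip2 (past w)) l = o] : set (g_sigma_algebraType H)).
Proof.
have mSome j : measurable
    ([set w | onth (unzip2 (past w)) l = Some j] : set (g_sigma_algebraType H)).
  rewrite (_ : [set w | _] = \bigcup_(q : rat) \bigcup_(q' : rat)
    [set w | [/\ 0 <= ratr q :> R, 0 <= ratr q' :> R,
      size (upto (ratr q) (past w)) = l, size (upto (ratr q') (past w)) = l.+1 &
      arrivals_upto j (ratr q') (past w) =
      (arrivals_upto j (ratr q) (past w)).+1]]); last first.
    apply/seteqP; split=> w /=.
      by case/(nth_type_jump _ _ (past_valid w)) => q [q' qq']; exists q => //; exists q'.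
    by case=> q _ [q' _ qq']; apply/(nth_type_jump _ _ (past_valid w)); exists q, q'.
  apply: bigcupT_measurable_rat => q; apply: bigcupT_measurable_rat => q'.
  apply: sub_sigma_algebra.
  have [q0|q0] := leP 0 (ratr q : R); last by exists [::] => // w w' _ [].
  have [q0'|q0'] := leP 0 (ratr q' : R); last by exists [::] => // w w' _ [].
  exists [:: Order.min (ratr q) s; Order.min (ratr q') s].
    by rewrite /= !le_min !ge_min !lexx q0 q0' s0 !orbT.
  move=> w w' ww' /=; rewrite !size_upto.
  have NE j' t : Order.min t s \in [:: Order.min (ratr q) s; Order.min (ratr q') s] ->
      arrivals_upto j' t (past w) = arrivals_upto j' t (past w').
    by move=> tt; rewrite !arrivals_upto_upto; exact: ww'.
  rewrite (NE j (ratr q)) ?mem_head// (NE j (ratr q')) ?inE ?eqxx ?orbT//.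
  rewrite (eq_bigr _ (fun j' _ => NE j' (ratr q) (mem_head _ _))).
  by rewrite (eq_bigr _ (fun j' _ => NE j' (ratr q') _)) ?inE ?eqxx ?orbT.
case: o => [j|]; first exact: mSome.
rewrite (_ : [set w | _] =
  ~` \bigcup_(j : types inst) [set w | onth (unzip2 (past w)) l = Some j]); last first.
  apply/seteqP; split=> [w /= oN [j _ /=]|w /= nj]; first by rewrite oN.
  by case E : onth => [j|//]; case: nj; exists j.
apply: measurableC; apply: fin_bigcup_measurable => //.
Qed.

Lemma measurable_past_types (js : seq (types inst)) :
  measurable ([set w | unzip2 (past w) = js] : set (g_sigma_algebraType H)).
Proof.
rewrite (_ : [set w | _] =
  \bigcap_(l : nat) [set w | onth (unzip2 (past w)) l = onth js l]).
  by apply: bigcapT_measurable => l; exact: measurable_past_type.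
apply/seteqP; split=> [w /= <-//|w /= E].
by apply: eq_from_onth => l; exact: E.
Qed.

Variable A : algorithm inst.

(** The algorithm is run on the truncated realization, which makes the event depend on the past
    alone by construction. For an online algorithm, [freeE] translates it back to the decisions on
    the full realization. *)
Definition assigned (i : offline inst) : set (seed A * arr_space M) :=
  [set x | exists2 k, (k < size (past x.2))%N & alloc x.1 (past x.2) k = Some i].

(** Once the number and the types of past arrivals are fixed, which is an event of the past, the
    realization is a measurable function of a tuple of times, and [alloc_measurable] applies. There
    are countably many such pieces. *)
Lemma measurable_assigned i :
  measurable (assigned i : set (seed A * g_sigma_algebraType H)).
Proof.
pose times m (w : g_sigma_algebraType H) : m.-tuple R :=
  [tuple (unzip1 (past w))`_l | l < m].
pose use m js (k : 'I_m) := [set x : (seed A * m.-tuple R)%type |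
      valid (zip x.2 js) /\ alloc x.1 (zip x.2 js) k = Some i].
rewrite (_ : assigned i = \bigcup_(m : nat) \bigcup_(js : m.-tuple (types inst))
   \bigcup_(k : 'I_m) ((setT `*` [set w | unzip2 (past w) = js]) `&`
      (fun x : seed A * g_sigma_algebraType H => (x.1, times m x.2)) @^-1`
        use m js k)); last first.
  have pastE m w (js : m.-tuple (types inst)) : unzip2 (past w) = js ->
      zip (times m w) js = past w.
    move=> jsE; have sm : size (past w) = m.
      by have := congr1 size jsE; rewrite size_map size_tuple.
    rewrite -jsE -[RHS]zip_unzip; congr zip.
    apply: (@eq_from_nth _ 0); first by rewrite size_tuple size_map.
    move=> l; rewrite size_tuple => lm.
    by rewrite (nth_map (Ordinal lm)) ?size_enum_ord// nth_enum_ord.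
  apply/seteqP; split=> [[u w] [k /= kw uk]|].
    have sz : size (unzip2 (past w)) == size (past w) by rewrite size_map.
    exists (size (past w)) => //; exists (Tuple sz) => //; exists (Ordinal kw) => //.
    by split; [split|rewrite /use /= (pastE _ _ (Tuple sz))].
  move=> [u w] [m _ [js _ [k _ [[_ /= jsE] [_ /=]]]]].
  rewrite (pastE _ _ js)// => uk; exists k => //=.
  by have := congr1 size jsE; rewrite size_map size_tuple => ->.
apply: bigcupT_measurable => m.
apply: fin_bigcup_measurable => // js _; apply: fin_bigcup_measurable => // k _.
apply: measurableI; first by apply: measurableX => //; exact: measurable_past_types.
rewrite -[X in measurable X]setTI.
have mt : measurable_fun [set: seed A * g_sigma_algebraType H]
    (fun x => (x.1, times m x.2)).
  apply/measurable_fun_pair => /=; first exact: measurable_fst.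
  apply: (@measurableT_comp _ _ _ _ _ _ (times m)) => //.
  apply/measurable_fun_tnthP => l.
  rewrite (_ : _ \o _ = fun w => (unzip1 (past w))`_l).
    exact: measurable_past_time.
  by apply/funext => w /=; rewrite tnth_mktuple.
by apply: mt => //; exact: alloc_measurable.
Qed.

End ObservedArrivals.

(** * Counting served arrivals *)

Section Load.
Context (R : realType) (inst : instance R).
Implicit Types (dec : nat -> option (offline inst)) (i : offline inst).

Lemma loadS dec k i : load dec k.+1 i = (load dec k i + (dec k == Some i))%N.
Proof. by rewrite /load -addn1 iotaD count_cat/= addn0. Qed.

Lemma load_mono dec i : {homo load dec ^~ i : k l / (k <= l)%N}.
Proof.
move=> k l kl; rewrite /load -(subnK kl) addnC iotaD count_cat.
exact: leq_addr.
Qed.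

Lemma load_eq0P dec k i :
  reflect (exists2 l, (l < k)%N & dec l = Some i) (load dec k i != 0%N).
Proof.
rewrite -lt0n /load -has_count; apply: (iffP hasP) => [[l]|[l lk dl]].
  by rewrite mem_iota add0n => /= lk /eqP; exists l.
by exists l; rewrite ?mem_iota ?add0n// dl.
Qed.

Lemma sum_load dec k :
  (\sum_i load dec k i = \sum_(l < k) (dec l != None))%N.
Proof.
elim: k => [|k IHk]; first by rewrite big_ord0 big1.
rewrite big_ord_recr/= -IHk; under eq_bigr do rewrite loadS.
rewrite big_split/=; congr addn.
case: (dec k) => [i|]; last by rewrite big1.
rewrite (bigD1 i)//= eqxx big1 ?addn0// => i' /negbTE i'i.
by rewrite (inj_eq Some_inj) eq_sym i'i.
Qed.

Variables (A : algorithm inst) (u : seed A) (a : realization R (types inst)).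
Hypothesis va : valid a.

Lemma load_le_cap k i : (k <= size a)%N -> (load (alloc u a) k i <= cap i)%N.
Proof.
elim: k => [//|k IHk] ka; rewrite loadS.
case: eqP => [dk|_]; last by rewrite addn0 IHk// ltnW.
have [] := andP (@alloc_feasible _ _ A u a (Ordinal ka) i va dk) => _ /= li.
by rewrite addn1.
Qed.

Lemma online_upto s k : online A -> (k < size (upto s a))%N ->
  alloc u (upto s a) k = alloc u a k.
Proof.
move=> oA ks; apply: oA => //; first exact: upto_valid.
  by rewrite (leq_trans ks)// size_filter count_size.
by rewrite upto_take// take_takel.
Qed.

End Load.

(** * Pathwise bounds on the hub instances *)

Section HubPointwise.
Context (R : realType) (n : nat) (n_ge2 : (2 <= n)%N).
Local Notation inst := (hub_instance R n_ge2).
Variables (A : algorithm inst) (u : seed A) (a : realization R (types inst)).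
Hypothesis va : valid a.
Local Notation N := (fun (j : 'I_n.+1) t => arrivals_upto (j : types inst) t a).
Local Notation load_at s i := (load (alloc u a) (size (upto s a)) (i : offline inst)).

Lemma arrivals_between (j : types inst) (s t : R) : s <= t ->
  (arrivals_upto j t a - arrivals_upto j s a)%N =
  (\sum_(k < size a | arrival_type k == j) (s < (tnth (in_tuple a) k).1 <= t)%R)%N.
Proof.
move=> st.
have NE r : arrivals_upto j r a =
    (\sum_(k < size a | arrival_type k == j) ((tnth (in_tuple a) k).1 <= r)%R)%N.
  rewrite /arrivals_upto -sum1_count big_tnth big_mkcondr/=.
  by apply: eq_bigr => k _; case: ifP.
rewrite !NE; apply/eqP; rewrite -(eqn_add2r (\sum_(k < size a | arrival_type k == j)
  ((tnth (in_tuple a) k).1 <= s)%R)%N) subnK; last first.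
  apply: leq_sum => k _; case: leP => // ks.
  by rewrite (le_trans ks st).
rewrite -big_split/=; apply/eqP; apply: eq_bigr => k _.
by have [ks|ks] := leP _ s; rewrite ?(le_trans ks st)// addn0.
Qed.

Lemma served_own_le (i : 'I_n) (m : nat) : (0 < m)%N ->
  (served (lift ord0 i : types inst) u a <=
   \sum_(q < m) (load_at (q%:R / m%:R)%R i == 0%N) *
     (N (lift ord0 i) (q.+1%:R / m%:R)%R - N (lift ord0 i) (q%:R / m%:R)%R))%N.
Proof.
move=> m0; rewrite /served.
have m0' : 0 < m%:R :> R by rewrite ltr0n.
under [leqRHS]eq_bigr => q _ do
  rewrite arrivals_between ?ler_pM2r ?invr_gt0 ?ler_nat// big_distrr/=.
rewrite exchange_big/=; apply: leq_sum => k /eqP kj.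
case dk : (alloc u a k) => [i'|]//=.
have /andP[] := @alloc_feasible _ _ A u a k i' va dk.
rewrite kj /= /hub_eligible/= => i'i; rewrite ltnS leqn0 => /eqP lk.
have {i'i} i'i : i' = i by case/orP: i'i => /eqP // /lift_inj.
rewrite {i'}i'i in dk lk.
set x := (tnth (in_tuple a) k).1.
have xE : x = (unzip1 a)`_k.
  by rewrite (nth_map (0, ord0))// /x (tnth_nth (0, ord0)).
have /andP[x0 x1] : 0 < x <= 1.
  have /andP[_ /allP] := va; apply; exact: mem_tnth.
(* The least such [q] is positive because [x] is, and its predecessor indexes the cell, open on the
   left, that contains [x]. *)
have exq : exists q, x <= q%:R / m%:R by exists m; rewrite divff// gt_eqF.
case: (ex_minnP exq) => -[|q] xq qmin; first by move: xq; rewrite mul0r leNgt x0.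
have qm : (q < m)%N.
  by apply: qmin; rewrite divff// gt_eqF.
have qx : q%:R / m%:R < x.
  by rewrite ltNge; apply/negP => /qmin; rewrite ltnn.
rewrite (bigD1 (Ordinal qm))//= -/x qx xq.
have -> : load_at (q%:R / m%:R : R) i = 0%N.
  apply/eqP; rewrite -leqn0 -lk; apply: load_mono.
  by rewrite leqNgt -nth_time_le// -xE -ltNge.
by rewrite eqxx.
Qed.

(** An agent [i0] still free at time [s] was available to every earlier hub arrival, so none of
    these was rejected and each consumed one unit of capacity. With no free agent the left side is
    0. *)
Lemma free_agents_le (s : R) : nonrejecting A ->
  (\sum_(i < n) (load_at s i == 0%N) <= n - N ord0 s)%N.
Proof.
move=> nrA; set c := size (upto s a).
have ca : (c <= size a)%N by rewrite /c size_filter count_size.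
have [/forallP H|] := boolP [forall i : 'I_n, load_at s i != 0%N].
  by rewrite big1// => i _; rewrite (negbTE (H i)).
rewrite negb_forall => /existsP[i0]; rewrite negbK => /eqP li0.
have -> : (n - N ord0 s)%N = (\sum_(i < n) 1 - N ord0 s)%N by rewrite sum1_card card_ord.
have le1 (i : 'I_n) : (load (alloc u a) c i <= 1)%N by exact: (@load_le_cap _ inst).
suff N0 : (N ord0 s <= \sum_(i < n) load (alloc u a) c i)%N.
  rewrite leq_subRL; last first.
    by rewrite (leq_trans N0)//; apply: leq_sum.
  rewrite (leq_trans (leq_add N0 (leqnn _)))// -big_split/=; apply: leq_sum => i _.
  by move: (le1 i); case: (load _ _ _) => [|[]].
rewrite (sum_load (alloc u a) c) arrivals_upto_count// -/c.
rewrite -sum1_count (big_nth ord0) big_mkord size_take size_map.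
have -> : (if (c < size a)%N then c else size a) = c.
  by move: ca; rewrite leq_eqVlt => /predU1P[->|->//]; rewrite ltnn.
rewrite big_mkcond/=; apply: leq_sum => l _; case: ifP => // /eqP jl.
have la : (l < size a)%N by exact: leq_trans ca.
have tl : arrival_type (Ordinal la) = ord0.
  rewrite -jl nth_take// /arrival_type (tnth_nth (0, ord0))/=.
  by rewrite (nth_map (0, ord0)).
have := @nrA u a (Ordinal la) i0 va; rewrite /can_serve tl/=.
have -> : load (alloc u a) l i0 = 0%N.
  by apply/eqP; rewrite -leqn0 -li0; apply: load_mono; exact: ltnW.
by move=> /(_ isT)/eqP->.
Qed.

End HubPointwise.

(** * Mean shortfall of a Poisson variable below a level *)

Section PoissonDeficit.
Context (R : realType).

(* Used with f the number of served agents, whose measurability is thus never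
   needed. *)
Lemma ge0_le_integral_nonmeasurable d (T : measurableType d)
    (mu : {measure set T -> \bar R}) (f g : T -> \bar R) :
  (forall x, 0 <= f x)%E -> (forall x, f x <= g x)%E ->
  (\int[mu]_x f x <= \int[mu]_x g x)%E.
Proof.
move=> f0 fg; have g0 x : (0 <= g x)%E by exact: le_trans (fg x).
rewrite !ge0_integralTE//; apply: le_ereal_sup => _ [h hf <-].
by exists h => // x; exact: le_trans (fg x).
Qed.

Lemma poisson_deficit_le d (T : measurableType d) (P : probability T R)
    (X : T -> nat) (lam delta : R) (n : nat) :
  (forall k, measurable [set w | X w = k]) ->
  (forall k, P [set w | X w = k] = (poisson_pmf lam k)%:E) ->
  0 < lam -> lam <= n%:R -> 0 < delta ->
  (\int[P]_w ((n - X w)%:R)%:E <=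
   (n%:R - lam + lam / (2 * delta) + delta / 2)%:E)%E.
Proof.
move=> mX XP lam0 lamn delta0.
(* (n - x)^+ <= n - lam + |lam - x|, then AM-GM with weight delta. *)
have pointwise (x : nat) : (n - x)%:R + lam / delta * x%:R <=
    (n%:R - lam + delta / 2 + lam ^+ 2 / (2 * delta)) + (2 * delta)^-1 * x%:R ^+ 2.
  have sq (y : R) : y <= delta / 2 + y ^+ 2 / (2 * delta).
    have := divr_ge0 (sqr_ge0 (delta - y)) (ltW (mulr_gt0 (ltr0n R 2) delta0)).
    rewrite (_ : _ / _ = delta / 2 + y ^+ 2 / (2 * delta) - y); first by rewrite subr_ge0.
    by field; rewrite gt_eqF.
  have max0 : (n - x)%:R <= n%:R - lam + Order.max (lam - x%:R) 0.
    have [xn|nx] := leqP x n.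
      rewrite natrB//; have : lam - x%:R <= Order.max (lam - x%:R) 0 by rewrite le_max lexx.
      by set z := Order.max _ _; lra.
    rewrite (_ : (n - x)%N = 0%N); last by apply/eqP; rewrite subn_eq0 ltnW.
    by rewrite addr_ge0 ?subr_ge0// le_max lexx orbT.
  have -> : n%:R - lam + delta / 2 + lam ^+ 2 / (2 * delta) + (2 * delta)^-1 * x%:R ^+ 2
     = n%:R - lam + (delta / 2 + (lam - x%:R) ^+ 2 / (2 * delta)) + lam / delta * x%:R.
    by field; rewrite gt_eqF.
  rewrite lerD2r (le_trans max0)// lerD2l ge_max sq/=.
  by rewrite addr_ge0// divr_ge0 ?sqr_ge0// ltW// ?mulr_gt0.
pose C := n%:R - lam + delta / 2 + lam ^+ 2 / (2 * delta).
have C0 : 0 <= C.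
  apply: addr_ge0; last by rewrite divr_ge0 ?sqr_ge0// ltW// mulr_gt0.
  by apply: addr_ge0; [rewrite subr_ge0|rewrite divr_ge0// ltW].
have mN (f : nat -> R) : measurable_fun [set: T] (fun w => (f (X w))%:E).
  by apply/measurable_EFinP; exact: measurable_countable_comp.
(* The cross term of the expanded square stands on the left, so both sides are sums of nonnegative
   functions and integrate termwise; it is cancelled only after integration, as a finite number. *)
have : (\int[P]_w ((n - X w)%:R + lam / delta * (X w)%:R)%:E <=
    \int[P]_w (C + (2 * delta)^-1 * (X w)%:R ^+ 2)%:E)%E.
  apply: ge0_le_integral_nonmeasurable => w; rewrite lee_fin//.
  by rewrite addr_ge0// mulr_ge0// divr_ge0// ltW.
under eq_integral do rewrite EFinD EFinM.
rewrite ge0_integralD//; [|exact: (mN (fun k => (n - k)%:R))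
  |by move=> w _; rewrite -EFinM lee_fin mulr_ge0// divr_ge0// ltW
  |exact: (mN (fun k => lam / delta * k%:R))].
rewrite ge0_integralZl//; last by rewrite lee_fin divr_ge0// ltW.
rewrite (poisson_mean lam0 mX XP).
under [leRHS]eq_integral do rewrite EFinD EFinM.
rewrite ge0_integralD//; [|move=> w _; rewrite -EFinM lee_fin mulr_ge0 ?sqr_ge0//;
    by rewrite invr_ge0 ltW// mulr_gt0
  |exact: (mN (fun k => (2 * delta)^-1 * k%:R ^+ 2))].
rewrite ge0_integralZl//; [|exact: (mN (fun k => k%:R ^+ 2))
  |by rewrite lee_fin invr_ge0 ltW// mulr_gt0].
rewrite (poisson_moment2 lam0 mX XP).
rewrite probability_integral_cst.
rewrite -!EFinM -EFinD => H; rewrite -(leeD2rE _ _ (_ : (lam / delta * lam)%:E \is a fin_num))//.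
rewrite (le_trans H)// -EFinD lee_fin le_eqVlt; apply/orP; left; apply/eqP.
by rewrite /C; field; rewrite gt_eqF.
Qed.

End PoissonDeficit.

(** * Online algorithms on the hub instances *)

Section HubUpperBound.
Context (R : realType) (n : nat) (n_ge2 : (2 <= n)%N).
Local Notation inst := (hub_instance R n_ge2).
Variables (M : arrival_model inst) (A : algorithm inst).
Hypotheses (oA : online A) (nrA : nonrejecting A).
Local Notation P := (arr_law M).
Local Notation Q := (seed_law A).
Local Notation N := (fun (j : types inst) t w => arrivals_upto j t (arr (a := M) w)).
Local Notation own i := (lift ord0 i : types inst).
Local Notation free s i := (~` @assigned R inst M s A i).

Let rate0 j : 0 < @rate R inst j. Proof. exact: rate_gt0. Qed.

Let n_gt0 : 0 < n%:R :> R. Proof. by rewrite ltr0n ltnW. Qed.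

Lemma freeE s i (x : seed A * arr_space M) : (x \in free s i) =
  (load (alloc x.1 (arr x.2)) (size (upto s (arr x.2))) (i : offline inst) == 0%N).
Proof.
have va := arr_valid x.2.
rewrite in_setC; apply/negb_inj; rewrite negbK; apply/idP/load_eq0P.
  rewrite inE => -[k ks dk]; exists k => //; by rewrite -dk; apply/esym/online_upto.
case=> k ks dk; rewrite inE; exists k => //; rewrite online_upto//.
Qed.

Lemma measurable_free s i : 0 <= s ->
  measurable (free s i : set (seed A * g_sigma_algebraType (history N s))).
Proof. by move=> s0; apply: measurableC; exact: measurable_assigned. Qed.

Lemma measurable_free_prod s i : 0 <= s -> s < 1 -> measurable (free s i).
Proof.
move=> s0 s1; apply: (measurable_history_prod (@arr_poisson R inst M)
  (@arr_indep R inst M) ord0 s0 s1 (lexx 1)).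
exact: measurable_free.
Qed.

Lemma expected_servedE (B : algorithm inst) (j : types inst) :
  expected_served M B j =
  (\int[(seed_law B \x P)%E]_x ((served j x.1 (arr x.2))%:R)%:E)%E.
Proof. by rewrite /expected_served unlock. Qed.

(** Integrates [served_own_le] cell by cell: being free at the left end is independent of the
    increment over the cell, whose mean is the rate 1 / n times the length 1 / m. *)
Lemma expected_own_le (i : 'I_n) (m : nat) : (0 < m)%N ->
  (expected_served M A (own i) <=
   \sum_(q < m) ((Q \x P) (free (q%:R / m%:R) i) * (n%:R^-1 * m%:R^-1)%:E))%E.
Proof.
move=> m0; have m0' : 0 < m%:R :> R by rewrite ltr0n.
have s0 q : 0 <= q%:R / m%:R :> R by rewrite divr_ge0.
have sS q : q%:R / m%:R < q.+1%:R / m%:R :> R.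
  by rewrite ltr_pM2r ?invr_gt0// ltr_nat.
have s1 (q : 'I_m) : q.+1%:R / m%:R <= 1 :> R.
  by rewrite ler_pdivrMr// mul1r ler_nat.
rewrite expected_servedE.
pose D q w := (N (own i) (q.+1%:R / m%:R) w - N (own i) (q%:R / m%:R) w)%N.
apply: (@le_trans _ _ (\int[(Q \x P)%E]_x
    \sum_(q < m) (\1_(free (q%:R / m%:R) i) x * (D q x.2)%:R)%:E)%E).
  apply: ge0_le_integral_nonmeasurable => x; first by rewrite lee_fin.
  rewrite sumEFin lee_fin.
  apply: (@le_trans _ _ (\sum_(q < m)
    (x \in free (q%:R / m%:R)%R i) * D q x.2)%N%:R).
    rewrite ler_nat; under eq_bigr => q _ do rewrite freeE.
    exact: (@served_own_le _ _ n_ge2 A x.1 _ (arr_valid x.2) i m m0).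
  by rewrite natr_sum ler_sum// => q _; rewrite natrM indicE.
have mprod q := product_history_increment_mean rate0 (@arr_poisson R inst M)
  (@arr_indep R inst M) (own i) (s0 q) (sS q).
rewrite ge0_integral_sum//; last first.
  move=> q; apply/measurable_EFinP; apply: measurable_funM.
    by apply: measurable_indic; apply: measurable_free_prod => //;
      exact: lt_le_trans (sS q) (s1 q).
  apply: (@measurableT_comp _ _ _ _ _ _ (fun w => (D q w)%:R : R)) => //.
  apply: (@measurable_countable_comp _ _ _ _ (D q) (fun k => k%:R)) => k.
  apply: (measurable_increment (@arr_poisson R inst M)).
    by rewrite s0 (le_trans _ (s1 q))// ltW.
  by rewrite s0 s1.
apply: lee_sum => q _.
rewrite (mprod q (s1 q) _ _ Q (free (q%:R / m%:R) i)); last exact: measurable_free.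
by rewrite /= /hub_rate/= -mulrBl -natrB// subSnn mul1r.
Qed.

Lemma sum_free_le (s : R) : 0 <= s -> s < 1 ->
  (\sum_(i < n) (Q \x P) (free s i) <=
   \int[P]_w ((n - N (ord0 : types inst) s w)%N%:R)%:E)%E.
Proof.
move=> s0 s1.
have mF i := measurable_free_prod i s0 s1.
have mN : measurable_fun [set: arr_space M]
    (fun w => (((n - N (ord0 : types inst) s w)%N%:R : R)%:E)).
  apply/measurable_EFinP.
  apply: (@measurable_countable_comp _ _ _ _ _ (fun k => (n - k)%N%:R)) => k.
  by apply: (measurable_process (@arr_poisson R inst M)); rewrite s0 ltW.
have -> : (\int[P]_w ((n - N (ord0 : types inst) s w)%N%:R)%:E =
    \int[(Q \x P)%E]_x ((n - N (ord0 : types inst) s x.2)%N%:R)%:E)%E.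
  by rewrite (integral_snd _ _ mN)// => w; rewrite lee_fin.
have IE i : ((Q \x P) (free s i) =
    \int[(Q \x P)%E]_x (\1_(free s i) x)%:E)%E by rewrite integral_indic// setIT.
under eq_bigr => i _ do rewrite IE.
rewrite -ge0_integral_sum//; last first.
  by move=> i; apply/measurable_EFinP; exact: measurable_indic.
apply: ge0_le_integral_nonmeasurable => x.
  by apply: sume_ge0 => i _; rewrite lee_fin.
rewrite sumEFin lee_fin.
apply: (@le_trans _ _ (\sum_(i < n) (x \in free s i))%N%:R).
  by rewrite natr_sum ler_sum// => i _; rewrite indicE.
rewrite ler_nat; under eq_bigr => i _ do rewrite freeE.
exact: free_agents_le (arr_valid _) _ nrA.
Qed.

End HubUpperBound.

(** * Fairness of non-rejecting online algorithms *)

Section HubFairnessBound.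
Context (R : realType) (n : nat) (n_ge2 : (2 <= n)%N).
Local Notation inst := (hub_instance R n_ge2).
Variables (M : arrival_model inst).
Local Notation P := (arr_law M).
Local Notation N := (fun (j : types inst) t w => arrivals_upto j t (arr (a := M) w)).

Let n_gt0 : 0 < n%:R :> R. Proof. by rewrite ltr0n ltnW. Qed.

Lemma arrivals_law j s k : 0 < s -> s <= 1 ->
  P [set w | N j s w = k] = (poisson_pmf (rate j * s) k)%:E.
Proof.
move=> s0 s1; have [_ _ _ /(_ 0 s (lexx 0) s0 s1 k)] := @arr_poisson R inst M j.
rewrite subr0 => <-; congr (P _); apply/seteqP.
by split=> w /=; rewrite (process0 (@arr_poisson R inst M)) subn0.
Qed.

Lemma measurable_arrivals j s k : 0 <= s <= 1 -> measurable [set w | N j s w = k].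
Proof. exact: (measurable_process (@arr_poisson R inst M)). Qed.

(** The shortfall bound with [delta = q]: the mean is at most [q ^ 2], so each of the two error
    terms is at most q / 2. Time 0 is separate because the shortfall bound asks for a positive
    mean. *)
Lemma hub_deficit_le (q : nat) (s : R) : n = (q ^ 2)%N -> 0 <= s -> s <= 1 ->
  (\int[P]_w ((n - N (ord0 : types inst) s w)%N%:R)%:E <=
    (n%:R - (n%:R - 1) * s + q%:R)%:E)%E.
Proof.
move=> nq; rewrite le_eqVlt => /predU1P[<- _|s0 s1].
  apply: (@le_trans _ _ (\int[P]_w (n%:R)%:E)%E).
    apply: ge0_le_integral_nonmeasurable => w; rewrite lee_fin//.
    by rewrite ler_nat leq_subr.
  by rewrite probability_integral_cst mulr0 subr0 lee_fin lerDl.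
have q0 : 0 < q%:R :> R.
  by rewrite ltr0n; move: n_ge2; rewrite nq; case: (q).
have n1 : 1 <= n%:R - 1 :> R by rewrite lerBrDr -[1 + 1]/(2%:R) ler_nat.
have lam0 : 0 < (n%:R - 1) * s by rewrite mulr_gt0// (lt_le_trans ltr01).
have lamn : (n%:R - 1) * s <= n%:R.
  rewrite (le_trans (_ : _ <= (n%:R - 1) * 1)) ?ler_wpM2l ?mulr1 ?lerBlDr ?lerDl//.
  by rewrite (le_trans ler01).
have := @poisson_deficit_le R _ _ P (N (ord0 : types inst) s) ((n%:R - 1) * s) q%:R n.
have mN k : measurable [set w | N (ord0 : types inst) s w = k].
  by apply: measurable_arrivals; rewrite s1 ltW.
have NP k : P [set w | N (ord0 : types inst) s w = k] =
    (poisson_pmf ((n%:R - 1) * s) k)%:E by exact: arrivals_law.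
move=> /(_ mN NP lam0 lamn q0) /le_trans; apply; rewrite lee_fin -addrA lerD2l.
rewrite [leRHS]splitr lerD2r ler_pdivrMr ?mulr_gt0//.
by rewrite (le_trans lamn)// nq natrX; lra.
Qed.

Section Online.
Variable A : algorithm inst.
Hypotheses (oA : online A) (nrA : nonrejecting A).

(** With [n] cells the sum evaluates to 1/2 + 1/q + 1/q^2 - 1/(2 q^4); the constant 2 / q absorbs
    everything after 1/2. *)
Lemma sum_expected_own_le (q : nat) : n = (q ^ 2)%N ->
  (\sum_(i < n) expected_served M A (lift ord0 i : types inst) <=
   (2^-1 + 2 / q%:R)%:E)%E.
Proof.
move=> nq.
have q0 : 0 < q%:R :> R.
  by rewrite ltr0n; move: n_ge2; rewrite nq; case: (q).
have n0 : (0 < n)%N by rewrite ltnW.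
pose c : R := n%:R^-1 * n%:R^-1.
pose free k i := ((seed_law A \x P) (~` @assigned R inst M (k%:R / n%:R) A i))%E.
apply: (@le_trans _ _ (\sum_(i < n) \sum_(k < n) (free k i * c%:E))%E).
  by apply: lee_sum => i _; exact: expected_own_le.
rewrite exchange_big/=.
apply: (@le_trans _ _ (\sum_(k < n)
    ((n%:R - (n%:R - 1) * (k%:R / n%:R) + q%:R) * c)%:E)%E).
  apply: lee_sum => k _; rewrite -ge0_sume_distrl; last by move=> i _; exact: measure_ge0.
  rewrite [leRHS]EFinM; apply: lee_wpmul2r; first by rewrite lee_fin mulr_ge0.
  have k0 : 0 <= k%:R / n%:R :> R by rewrite divr_ge0.
  have k1 : k%:R / n%:R < 1 :> R by rewrite ltr_pdivrMr// mul1r ltr_nat.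
  apply: (le_trans (sum_free_le M oA nrA k0 k1)).
  exact: hub_deficit_le (ltW k1).
rewrite sumEFin lee_fin -mulr_suml.
have gauss m : \sum_(k < m) (k%:R : R) = m%:R * (m%:R - 1) / 2.
  elim: m => [|m IHm]; first by rewrite big_ord0 !mul0r.
  by rewrite big_ord_recr/= IHm -natr1; field.
have -> : \sum_(k < n) (n%:R - (n%:R - 1) * (k%:R / n%:R) + q%:R) =
    (n%:R + q%:R) * n%:R - (n%:R - 1) / n%:R * (n%:R * (n%:R - 1) / 2) :> R.
  rewrite (eq_bigr (fun k : 'I_n => n%:R + q%:R - (n%:R - 1) / n%:R * k%:R)); last first.
    by move=> k _; field; rewrite gt_eqF.
  by rewrite sumrB sumr_const card_ord -mulr_sumr gauss -[(_ + _) *+ n]mulr_natr.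
have qn : n%:R = q%:R ^+ 2 :> R by rewrite nq natrX.
have q1 : 1 <= q%:R :> R by rewrite ler1n -(ltr0n R).
rewrite /c qn -subr_ge0.
rewrite (_ : _ - _ = q%:R^-1 * (1 - q%:R^-1) + q%:R ^- 4 / 2); last first.
  by field; rewrite gt_eqF.
rewrite addr_ge0 ?mulr_ge0 ?invr_ge0 ?exprn_ge0 ?subr_ge0 ?invf_le1//.
Qed.

Lemma fairness_le (q : nat) (r : R) : n = (q ^ 2)%N ->
  (r%:E <= long_run_fairness M A)%E -> r <= 2^-1 + 2 / q%:R.
Proof.
move=> nq rA; rewrite -lee_fin; apply: le_trans (sum_expected_own_le nq).
have rE (i : 'I_n) : ((r / n%:R)%:E <= expected_served M A (lift ord0 i : types inst))%E.
  have : (r%:E <= expected_served M A (lift ord0 i : types inst) * n%:R%:E)%E.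
    apply: (le_trans rA); rewrite /long_run_fairness.
    have := @bigmin_le _ _ _ +oo%E (lift ord0 i : types inst)
      (fun j => expected_served M A j * (rate j)^-1%:E)%E.
    by rewrite /= /hub_rate/= invrK.
  by rewrite EFinM => rE; rewrite lee_pdivrMr.
rewrite (_ : r = \sum_(i < n) (r / n%:R)); last first.
  by rewrite sumr_const card_ord -[_ / _ *+ _]mulr_natr divfK// gt_eqF.
by rewrite -sumEFin; apply: lee_sum => i _; exact: rE.
Qed.

End Online.
End HubFairnessBound.

(** * The clairvoyant reservation policy *)

Lemma measurable_valid (R : realType) (J : finType) (m : nat) (js : m.-tuple J) :
  measurable [set x : m.-tuple R | valid (zip x js)].
Proof.
pose f (i : 'I_m) (x : m.-tuple R) : R := tnth x i.
have mf i : measurable_fun [set: m.-tuple R] (f i) by exact: measurable_tnth.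
rewrite (_ : [set x | _] =
  (\bigcap_(p : 'I_m * 'I_m) [set x | (p.1 < p.2)%N -> f p.1 x < f p.2 x]) `&`
  (\bigcap_(i : 'I_m) [set x | 0 < f i x <= 1])).
  apply: measurableI; apply: fin_bigcap_measurable => //.
    move=> [i i'] _ /=; case: (i < i')%N.
      rewrite (_ : [set x | _] = (fun x => f i x < f i' x) @^-1` [set true]).
        rewrite -[X in measurable X]setTI; apply: measurable_fun_ltr => //.
      by apply/seteqP; split=> x /=; [apply|].
    by rewrite (_ : [set x | _] = setT)//; apply/seteqP; split.
  move=> i _; rewrite (_ : [set x | _] = f i @^-1` `]0, 1]).
    by rewrite -[X in measurable X]setTI; apply: mf.
  by apply/seteqP; split=> x /=; rewrite in_itv.
have validE (x : m.-tuple R) :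
    valid (zip x js) = sorted <%R x && all (fun y => 0 < y <= 1) x.
  have zE : unzip1 (zip x js) = x by rewrite unzip1_zip// !size_tuple.
  by rewrite -[in RHS]zE all_map.
apply/seteqP; split=> [x|x [H1 H2]] /=; rewrite validE.
  case/andP => sx /allP ax; split=> [[i i'] _ /= ii'|i _ /=]; last exact/ax/mem_tnth.
  rewrite /f !(tnth_nth 0); apply: (sorted_ltn_nth lt_trans) => //; rewrite inE size_tuple//.
apply/andP; split; last first.
  by apply/allP => y /tnthP[i ->]; exact: H2.
apply/(sortedP 0) => l; rewrite size_tuple => lm.
by have := H1 (Ordinal (ltnW lm), Ordinal lm) I (ltnSn l); rewrite /f !(tnth_nth 0).
Qed.

Section HubClairvoyant.
Context (R : realType) (n : nat) (n_ge2 : (2 <= n)%N).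
Local Notation inst := (hub_instance R n_ge2).
Implicit Types (js : seq 'I_n.+1) (i : 'I_n) (k l : nat).

Definition unrequested js : seq 'I_n := [seq i <- enum 'I_n | lift ord0 i \notin js].

(* The decision on the k-th arrival: agent i takes the first arrival of its own
   type, and the hub arrivals go in turn to the agents whose own type never
   occurs. *)
Definition reserve js k : option 'I_n :=
  let j := nth ord0 js k in
  let r := count_mem j (take k js) in
  if unlift ord0 j is Some i then if r == 0%N then Some i else None
  else onth (unrequested js) r.

Lemma reserve_own js k i : nth ord0 js k = lift ord0 i ->
  reserve js k = if count_mem (lift ord0 i) (take k js) == 0%N then Some i else None.
Proof. by move=> jE; rewrite /reserve jE liftK. Qed.

Lemma reserve_hub js k : nth ord0 js k = ord0 ->
  reserve js k = onth (unrequested js) (count_mem ord0 (take k js)).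
Proof. by move=> jE; rewrite /reserve jE unlift_none. Qed.

Lemma count_take_lt js j k l : (l < k)%N -> (l < size js)%N -> nth ord0 js l = j ->
  (count_mem j (take l js) < count_mem j (take k js))%N.
Proof.
move=> lk ljs jl; rewrite -(cat_take_drop l (take k js)) take_takel ?(ltnW lk)//.
rewrite count_cat -[X in (X < _)%N]addn0 ltn_add2l -has_count.
apply/hasP; exists j => //=; rewrite -jl.
have lt : (l < size (take k js))%N by rewrite size_take; case: ifP => // _.
by rewrite (drop_nth ord0 lt) inE nth_take// eqxx.
Qed.

Lemma reserve_eligible js k i : reserve js k = Some i ->
  hub_eligible i (nth ord0 js k).
Proof.
rewrite /hub_eligible; case: (unliftP ord0 (nth ord0 js k)) => [i' jE|->];
  last by rewrite orbC.
by rewrite (reserve_own jE) jE; case: ifP => // _ [->]; rewrite eqxx.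
Qed.

(** Two own-type arrivals: the later one sees a positive count. One own-type and one hub arrival:
    the agent would be both requested and unrequested. Two hub arrivals: their ranks differ and
    [unrequested] has no duplicates. *)
Lemma reserve_once js k l i : (k < size js)%N -> (l < k)%N ->
  reserve js k = Some i -> reserve js l = Some i -> False.
Proof.
move=> kjs lk; have ljs := ltn_trans lk kjs.
have freeP m i' : onth (unrequested js) m = Some i' -> lift ord0 i' \notin js.
  move=> mi; have : i' \in unrequested js by apply/onthP; exists m.
  by rewrite mem_filter => /andP[].
case: (unliftP ord0 (nth ord0 js k)) => [ik kE|kE];
  case: (unliftP ord0 (nth ord0 js l)) => [il lE|lE].
- rewrite (reserve_own kE) (reserve_own lE).
  case: eqP => // k0 [ii]; case: ifP => // _ [li].
  by have := count_take_lt lk ljs lE; rewrite li -ii k0 ltn0.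
- rewrite (reserve_own kE) (reserve_hub lE); case: ifP => // _ [<-] /freeP.
  by rewrite -kE mem_nth.
- rewrite (reserve_hub kE) (reserve_own lE) => /freeP iE; case: ifP => // _ [li].
  by move: iE; rewrite -li -lE mem_nth.
- rewrite (reserve_hub kE) (reserve_hub lE) => kO lO.
  have := count_take_lt lk ljs lE.
  have -> : count_mem ord0 (take l js) = count_mem ord0 (take k js); last by rewrite ltnn.
  apply: (@onth_inj _ (unrequested js)); last by rewrite kO lO.
    by rewrite filter_uniq// enum_uniq.
  by rewrite gtn_min -!onthTE kO.
Qed.

Lemma reserve_feasible (a : realization R (types inst)) (k : 'I_(size a)) i :
  reserve (unzip2 a) k = Some i ->
  can_serve (inst := inst) (reserve (unzip2 a)) k i (arrival_type k).
Proof.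
move=> ki; rewrite /can_serve.
have -> : arrival_type k = nth ord0 (unzip2 a) k.
  by rewrite /arrival_type (tnth_nth (0, ord0)) (nth_map (0, ord0)).
rewrite /= reserve_eligible//= ltnS leqn0; apply/eqP/eqP.
rewrite -[_ == _]negbK; apply/negP => /(load_eq0P (inst := inst)) [l lk].
by apply: (reserve_once _ lk ki); rewrite size_map.
Qed.

(** The policy reads types only, and these are fixed here, so the set is empty or cut out by
    validity alone. *)
Lemma reserve_measurable (m : nat) (js : m.-tuple (types inst)) (k : 'I_m) i :
  measurable [set x : (unit * m.-tuple R)%type |
    valid (zip x.2 js) /\ reserve (unzip2 (zip x.2 js)) k = Some i].
Proof.
have jsE (x : m.-tuple R) : unzip2 (zip x js) = js by rewrite unzip2_zip// !size_tuple.
have [ki|ki] := pselect (reserve js k = Some i).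
  rewrite (_ : [set x | _] = snd @^-1` [set x : m.-tuple R | valid (zip x js)]).
    rewrite -[X in measurable X]setTI; apply: measurable_snd => //.
    exact: measurable_valid.
  by apply/seteqP; split=> [x []//|x vx]; split=> //; rewrite jsE.
rewrite (_ : [set x | _] = set0)//; apply/seteqP; split=> // x [_ /=].
by rewrite jsE.
Qed.

Definition reservation : algorithm inst :=
  @Algorithm R inst _ unit (\d_tt) (fun _ a => reserve (unzip2 a))
    (fun _ a (k : 'I_(size a)) i _ => @reserve_feasible a k i) reserve_measurable.

Section Served.
Variables (u : unit) (a : realization R (types inst)).
Local Notation js := (unzip2 a : seq 'I_n.+1).
Local Notation N j := (count_mem j js).

Lemma reservation_servedE (j : types inst) :
  served (A := reservation) j u a =
  (\sum_(k < size js) (nth ord0 js k == j) * (reserve js k != None))%N.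
Proof.
rewrite /served size_map big_mkcond; apply: eq_bigr => k _.
have -> : arrival_type k = nth ord0 js k.
  by rewrite /arrival_type (tnth_nth (0, ord0)) (nth_map (0, ord0)).
by case: eqP; rewrite ?mul1n ?mul0n.
Qed.

Lemma reservation_served_own i :
  ((0 < N (lift ord0 i))%N <= served (A := reservation) (lift ord0 i : types inst) u a)%N.
Proof.
rewrite reservation_servedE -has_count has_pred1; case: (boolP (_ \in _)) => // ijs.
have ind : (index (lift ord0 i) js < size js)%N by rewrite index_mem.
rewrite (bigD1 (Ordinal ind))//= nth_index// eqxx mul1n.
rewrite (reserve_own (nth_index _ ijs)).
have -> : count_mem (lift ord0 i) (take (index (lift ord0 i) js) js) = 0%N.
  apply/count_memPn; apply/negP => /nthP-/(_ ord0)[l].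
  rewrite size_take ind => li; rewrite nth_take// => lE.
  by have := before_find ord0 li; rewrite /= lE eqxx.
by [].
Qed.

Lemma reservation_served_hub :
  served (A := reservation) (ord0 : types inst) u a =
  minn (N ord0) (size (unrequested js)).
Proof.
rewrite reservation_servedE.
have H m : (m <= size js)%N ->
    (\sum_(k < m) (nth ord0 js k == ord0) * (reserve js k != None))%N =
    minn (count_mem ord0 (take m js)) (size (unrequested js)).
  elim: m => [|m IHm] ms; first by rewrite big_ord0 take0 min0n.
  rewrite big_ord_recr/= IHm 1?ltnW// (take_nth ord0)// -cats1 count_cat/= addn0.
  case: eqP => [m0|_]; last by rewrite mul0n !addn0.
  rewrite (reserve_hub m0) mul1n.
  have -> : (onth (unrequested js) (count_mem ord0 (take m js)) != None) =
     (count_mem ord0 (take m js) < size (unrequested js))%N.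
    by rewrite -onthTE; case: onth.
  move: (count_mem _ _) (size _) => c F. by case: (ltnP c F); lia.
by rewrite H// take_size.
Qed.

(** Each agent missing from [unrequested] is paid for by at least one arrival of its own type. *)
Lemma size_unrequested :
  (n <= size (unrequested js) + \sum_(i < n) N (lift ord0 i))%N.
Proof.
rewrite size_filter -sum1_count big_mkcond/= big_enum/= -big_split/=.
rewrite -[leqLHS]card_ord -sum1_card; apply: leq_sum => i _.
by case: ifPn => //; rewrite negbK add0n -has_pred1 has_count.
Qed.

End Served.
End HubClairvoyant.

(** * Fairness of the reservation policy *)

Section ReservationFairness.
Context (R : realType) (n : nat) (n_ge2 : (2 <= n)%N).
Local Notation inst := (hub_instance R n_ge2).
Variable M : arrival_model inst.
Local Notation P := (arr_law M).
Local Notation N := (fun (j : types inst) w => arrivals_upto j 1 (arr (a := M) w)).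
Local Notation B := (@reservation R n n_ge2).

Let n_gt0 : 0 < n%:R :> R. Proof. by rewrite ltr0n ltnW. Qed.

Let mN j k : measurable [set w | N j w = k].
Proof. by apply: measurable_arrivals; rewrite ler01 lexx. Qed.

Let N_law j k : P [set w | N j w = k] = (poisson_pmf (rate j) k)%:E.
Proof. by have := @arrivals_law R n n_ge2 M j 1 k ltr01 (lexx 1); rewrite mulr1. Qed.

Let N_count j w : N j w = count_mem j (unzip2 (arr (a := M) w)).
Proof.
rewrite count_map; apply: eq_in_count => x xa /=.
by have /andP[_ /allP/(_ x xa)/andP[_ ->]] := arr_valid w; rewrite andbT.
Qed.

Lemma expected_served_ge (j : types inst) (V : countType)
    (X : arr_space M -> V) (g : V -> nat) :
  (forall v, measurable [set w | X w = v]) ->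
  (forall w, (g (X w) <= served (A := B) j tt (arr w))%N) ->
  (\int[P]_w (g (X w))%:R%:E <= expected_served M B j)%E.
Proof.
move=> mX gle; rewrite expected_servedE.
have mg : measurable_fun [set: arr_space M] (fun w => ((g (X w))%:R : R)%:E).
  by apply/measurable_EFinP; exact: (measurable_countable_comp (fun v => (g v)%:R)).
rewrite -(integral_snd P (seed_law B) mg); last by move=> w; rewrite lee_fin.
apply: ge0_le_integral_nonmeasurable => x; first by rewrite lee_fin.
by rewrite lee_fin ler_nat; case: x => -[].
Qed.

(** With x = 1 / n, the probability of at least one own-type arrival is 1 - exp(-x), and exp(-x) <=
    1 / (1 + x) <= 1 - x + x^2. *)
Lemma expected_reservation_own (i : 'I_n) :
  ((n%:R^-1 * (1 - n%:R^-1))%:E <= expected_served M B (lift ord0 i : types inst))%E.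
Proof.
set j := (lift ord0 i : types inst).
apply: le_trans (expected_served_ge (j := j) (g := fun k => nat_of_bool (0 < k)%N) (mN j) _);
  last by move=> w /=; rewrite N_count; exact: reservation_served_own.
have -> : (\int[P]_w ((0 < N j w)%N%:R)%:E = P (~` [set w | N j w = 0%N]))%E.
  rewrite -[in RHS](setIT (~` _)) -integral_indic//; last exact: measurableC.
  apply: eq_integral => w _; congr EFin; rewrite indicE.
  by rewrite in_setC lt0n; congr (nat_of_bool (~~ _))%:R; apply/eqP/idP; rewrite inE.
rewrite probability_setC// N_law lee_fin /poisson_pmf rate_gt0 expr0 fact0 invr1 !mul1r.
rewrite /= /hub_rate/=.
set x := n%:R^-1; have x0 : 0 < x by rewrite invr_gt0.
have e1 : expR (- x) <= (1 + x)^-1.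
  by rewrite expRN lef_pV2 ?posrE ?expR_gt0 ?addr_gt0// expR_ge1Dx.
have e2 : (1 + x)^-1 <= 1 - x + x ^+ 2.
  rewrite -[leLHS]div1r ler_pdivrMr ?addr_gt0//.
  have x3 : 0 <= x ^+ 3 by rewrite exprn_ge0// ltW.
  have -> : (1 - x + x ^+ 2) * (1 + x) = 1 + x ^+ 3 by ring.
  by rewrite lerDl.
lra.
Qed.

Lemma expected_reservation_hub (q : nat) : n = (q ^ 2)%N ->
  ((n%:R - 2 - q%:R)%:E <= expected_served M B (ord0 : types inst))%E.
Proof.
move=> nq.
(* All type counts form one countably valued variable, as [expected_served_ge] expects. *)
pose X w := [ffun j : types inst => N j w].
have mX v : measurable [set w | X w = v].
  rewrite (_ : [set w | _] = \bigcap_(j : types inst) [set w | N j w = v j]).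
    by apply: fin_bigcap_measurable => // j _; exact: mN.
  apply/seteqP; split=> [w /= <- j _|w H]; first by rewrite ffunE.
  by apply/ffunP => j; rewrite ffunE; exact: H.
pose own (v : {ffun types inst -> nat}) := (\sum_(i < n) v (lift ord0 i : 'I_n.+1))%N.
pose g (v : {ffun types inst -> nat}) := (minn (v ord0) n - own v)%N.
have gle w : (g (X w) <= served (A := B) (ord0 : types inst) tt (arr w))%N.
  rewrite reservation_served_hub /g /own ffunE N_count.
  under eq_bigr => i _ do rewrite ffunE N_count.
  have := size_unrequested (arr w).
  set S := (\sum_(i < n) _)%N; move: S => S.
  move: (count_mem _ _) (size _) => c F; lia.
apply: le_trans (expected_served_ge (j := ord0) mX gle).
have deficit : (\int[P]_w ((n - N (ord0 : types inst) w)%N%:R)%:E <= (1 + q%:R)%:E)%E.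
  have := hub_deficit_le M nq ler01 (lexx 1).
  by rewrite (_ : n%:R - _ + _ = 1 + q%:R)//; ring.
have mean i : (\int[P]_w ((X w (lift ord0 i : 'I_n.+1))%:R)%:E = (n%:R^-1)%:E)%E.
  under eq_integral do rewrite ffunE.
  exact: (poisson_mean (rate_gt0 _) (mN _) (N_law _)).
have mc (f : {ffun types inst -> nat} -> nat) :
    measurable_fun [set: arr_space M] (fun w => ((f (X w))%:R : R)%:E).
  by apply/measurable_EFinP; exact: (measurable_countable_comp (fun v => (f v)%:R)).
have meanS : (\int[P]_w ((own (X w))%:R)%:E = 1)%E.
  under eq_integral => w _ do rewrite natr_sum -sumEFin.
  rewrite ge0_integral_sum//; last first.
    by move=> i; exact: (mc (fun v => v (lift ord0 i : 'I_n.+1))).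
  rewrite (eq_bigr _ (fun i _ => mean i)) sumEFin sumr_const card_ord.
  by rewrite -[_ *+ _]mulr_natr mulVf// gt_eqF.
(* Pointwise, [n] is at most [g] plus the own-type arrivals plus the hub shortfall. The last two
   have means 1 and at most 1 + q, hence the loss 2 + q. *)
have : (n%:R%:E <= \int[P]_w ((g (X w))%:R%:E + (own (X w))%:R%:E
    + ((n - X w ord0)%N%:R)%:E))%E.
  rewrite -[leLHS](probability_integral_cst P).
  apply: ge0_le_integral_nonmeasurable => w; rewrite lee_fin//.
  by rewrite -!natrD ler_nat /g; lia.
rewrite ge0_integralD//; [|by move=> w _; rewrite -EFinD lee_fin addr_ge0
  |by apply: emeasurable_funD; exact: mc|exact: (mc (fun v => n - v ord0)%N)].
rewrite ge0_integralD// meanS.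
have -> : (\int[P]_w ((n - X w ord0)%N%:R)%:E =
    \int[P]_w ((n - N (ord0 : types inst) w)%N%:R)%:E)%E.
  by apply: eq_integral => w _; rewrite ffunE.
set I := (\int[P]_w ((g (X w))%:R)%:E)%E => H.
have {}H : (n%:R%:E <= I + (2 + q%:R)%:E)%E.
  apply: (le_trans H); rewrite -addeA leeD2l//.
  rewrite (_ : 2 + q%:R = 1 + (1 + q%:R)); last by rewrite addrA.
  by rewrite EFinD leeD2l.
by rewrite -addrA -opprD EFinB leeBlDr.
Qed.

(** The hub type dictates the bound: (q^2 - q - 2) / (q^2 - 1) = (q - 2) / (q - 1). Own types reach
    1 - 1 / q^2, which is larger. *)
Lemma clairvoyant_opt_ge (q : nat) : n = (q ^ 2)%N ->
  ((1 - (q%:R - 1)^-1)%:E <= clairvoyant_opt M)%E.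
Proof.
move=> nq.
have q_ge2 : (2 <= q)%N by move: n_ge2; rewrite nq; case: (q) => [|[]].
have q1 : 0 < q%:R - 1 :> R by rewrite subr_gt0 ltr1n.
have qn : n%:R = q%:R ^+ 2 :> R by rewrite nq natrX.
apply: (@le_trans _ _ (long_run_fairness M B)); last first.
  by apply: ereal_sup_ubound; exists B.
apply: le_bigmin => [|j _]; first exact: leey.
case: (unliftP ord0 (j : 'I_n.+1)) => [i ->|->]; rewrite /= /hub_rate/=.
  rewrite invrK -lee_pdivrMr// -EFinM; apply: le_trans (expected_reservation_own i).
  rewrite lee_fin mulrC ler_pM2l ?invr_gt0// lerD2l lerN2 lef_pV2 ?posrE// qn.
  by nra.
have n1 : 0 < n%:R - 1 :> R by rewrite subr_gt0 ltr1n.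
have -> : 1 - (q%:R - 1)^-1 = (n%:R - 2 - q%:R) * (n%:R - 1)^-1 :> R.
  have q1' : 0 < q%:R + 1 :> R by rewrite addr_gt0// ltr0n ltnW.
  rewrite qn; field.
  by rewrite -[q%:R ^+ 2 - 1]/(q%:R ^+ 2 - 1) subr_sqr_1 mulf_neq0 gt_eqF.
rewrite EFinM; apply: lee_wpmul2r; first by rewrite lee_fin invr_ge0 ltW.
exact: expected_reservation_hub.
Qed.

End ReservationFairness.

Theorem theorem1 (R : realType)
    (M : forall k : {n : nat | (2 <= n)%N}, arrival_model (hub_family R k))
    (A : forall k : {n : nat | (2 <= n)%N}, algorithm (hub_family R k))
    (A_online : forall k, online (A k))
    (A_nonrejecting : forall k, nonrejecting (A k)) :
  ~ exists c : R, 1 / 2 < c /\ competitive M A c.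
Proof.
case=> c [c2 cA].
have e0 : 0 < c - 2^-1 by rewrite subr_gt0 -div1r.
have c0 : 0 <= c by rewrite ltW// (lt_trans _ c2)// divr_gt0.
(* With q = m + 2, competitiveness would give c (1 - 1/(m+1)) <= 1/2 + 2/(m+2). This fails as soon
   as (2 + c) / (m + 1) < c - 1/2, which the choice of [m] ensures. *)
pose m := Num.bound ((2 + c) / (c - 2^-1)).
have mP : (2 + c) / (c - 2^-1) < m%:R.
  by apply: archi_boundP; rewrite divr_ge0 ?ltW// addr_gt0// (lt_trans _ c2)// divr_gt0.
pose q := m.+2.
have q2 : (2 <= q ^ 2)%N by rewrite -mulnn.
pose k : {n : nat | (2 <= n)%N} := exist _ (q ^ 2)%N q2.
have opt := @clairvoyant_opt_ge R _ (svalP k) (M k) q erefl.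
have fair : ((c * (1 - (q%:R - 1)^-1))%:E <= long_run_fairness (M k) (A k))%E.
  by apply: le_trans (cA k); rewrite EFinM; apply: lee_wpmul2l.
have := @fairness_le R _ (svalP k) (M k) (A k) (A_online k) (A_nonrejecting k) q _ erefl fair.
apply/negP; rewrite -ltNge.
have qm : q%:R - 1 = m.+1%:R :> R by rewrite -[m.+2%:R]natr1 addrK.
have m1 : 0 < m.+1%:R :> R by [].
have qle : 2 / q%:R <= 2 / m.+1%:R :> R.
  by rewrite ler_pM2l// lef_pV2 ?posrE// ler_nat.
rewrite qm mulrBr mulr1 ltrBrDr (le_lt_trans (y := 2^-1 + (2 + c) / m.+1%:R))//.
  by rewrite [(2 + c) / _]mulrDl addrA lerD2r lerD2l.
by rewrite -ltrBrDl ltr_pdivrMr// mulrC -ltr_pdivrMr// (lt_trans mP)// ltr_nat.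
Qed.
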